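(* Let $\mathscr{M}$ be a calibrated bicategory. There is a bicategory $\mathrm{Poly}\,\mathscr{M}$ whose objects are those of $\mathscr{M}$, whose homcategories are the categories $\mathrm{Poly}\,\mathscr{M}(X,Y)$ of polynomials and isomorphism classes of polynomial morphisms, whose composition is given by the polynomial composition functors $\circ:\mathrm{Poly}\,\mathscr{M}(Y,Z)\times\mathrm{Poly}\,\mathscr{M}(X,Y)\to\mathrm{Poly}\,\mathscr{M}(X,Z)$ (described in the context), whose identity morphisms are the identity spans $(1_X,X,1_X)$, and whose associativity isomorphisms are provided by the vertical and horizontal stacking properties of bipullbacks.
   Context: **Bipullback.** In a bicategory $\mathscr{M}$, a square given by $d:P\to A$, $c:P\to B$, $n:A\to C$, $p:B\to C$ and an invertible 2-cell $\theta:nd\Rightarrow pc$ is a bipullback of $(n,p)$ when, for all objects $K$, the functor $\mathscr{M}(K,P)\to \mathscr{M}(K,n)/_{\mathrm{ps}}\mathscr{M}(K,p)$, $u\mapsto(du,\theta u,cu)$, is an equivalence. Here, for functors $F:\mathscr{X}\to\mathscr{Z}$ and $G:\mathscr{Y}\to\mathscr{Z}$, the category $F/_{\mathrm{ps}}G$ has objects $(x,\alpha,y)$ with $\alpha:Fx\cong Gy$, and morphisms $(s,t):(x,\alpha,y)\to(x',\alpha',y')$ the pairs with $(Gt)\alpha=\alpha'(Fs)$. **Groupoid fibration.** A functor $p:E\to B$ is a groupoid fibration when (i) for all $e\in E$ and $\beta:b\to pe$ in $B$ there exist $\chi:e'\to e$ in $E$ and an isomorphism $b\cong pe'$ whose composite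 with $p\chi$ is $\beta$; and (ii) every morphism $\chi:e'\to e$ of $E$ is cartesian: for all $k\in E$ the square with sides $E(k,\chi):E(k,e')\to E(k,e)$, $B(pk,p\chi):B(pk,pe')\to B(pk,pe)$ and the two functions induced by $p$ is a pullback. A morphism $p:E\to B$ in a bicategory $\mathscr{M}$ is a groupoid fibration when the functor $\mathscr{M}(K,p)$ is one for every object $K$. **Right lifter.** A morphism $n:Y\to Z$ in $\mathscr{M}$ is a right lifter when every $u:K\to Z$ has a right lifting through $n$: a morphism $\mathrm{rif}(n,u):K\to Y$ with a 2-cell $\varpi:n\,\mathrm{rif}(n,u)\Rightarrow u$ such that pasting with $\varpi$ is a bijection between 2-cells $v\Rightarrow\mathrm{rif}(n,u)$ and 2-cells $nv\Rightarrow u$, for all $v:K\to Y$. **Calibration.** A class $\mathscr{P}$ of morphisms (called neat) of a bicategory $\mathscr{M}$ is a calibration when: (P0) all equivalences are neat, and any morphism isomorphic to a neat one is neat; (P1) for all neat $p$, a composite $p\circ q$ is neat if and only if $q$ is neat; (P2) every neat morphism is a groupoid fibration; (P3) every cospan $S\xrightarrow{p}Y\xleftarrow{n}T$ with $n$ a right lifter and $p$ neat has a bipullback with projections $\tilde n:P\to S$, $\tilde p:P\to T$ and invertible $\theta:n\tilde p\Rightarrow p\tilde n$, in which $\tilde p$ is neat. A bicategory equipped with a calibration is called calibrated. **Polynomials.** A polynomial $(m,S,p)$ from $X$ to $Y$ is a span $X\xleftarrow{m}S\xrightarrow{p}Y$ in $\mathscr{M}$ with $m$ a right lifter and $p$ neat.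 A polynomial morphism $(\lambda,h,\rho):(m,S,p)\to(m',S',p')$ is a morphism $h:S\to S'$ with a 2-cell $\lambda:m'h\Rightarrow m$ and an invertible 2-cell $\rho:p\Rightarrow p'h$. A 2-cell $(\lambda,h,\rho)\Rightarrow(\lambda',k,\rho')$ is a 2-cell $\sigma:h\Rightarrow k$ with $\lambda=\lambda'\cdot(m'\sigma)$ and $\rho'=(p'\sigma)\cdot\rho$; all such $\sigma$ are invertible. The category $\mathrm{Poly}\,\mathscr{M}(X,Y)$ has the polynomials from $X$ to $Y$ as objects and isomorphism classes $[\lambda,h,\rho]$ of polynomial morphisms as morphisms. **Composition.** The composite of $(m,S,p):X\to Y$ and $(n,T,q):Y\to Z$ is $(m\tilde n,P,q\tilde p)$, where $P,\tilde n,\tilde p,\theta$ is the bipullback in (P3). For $[\lambda_h,h,\rho_h]:(m,S,p)\to(m',S',p')$ and $[\lambda_k,k,\rho_k]:(n,T,q)\to(n',T',q')$, let $$\psi=\big(n'k\tilde p\xRightarrow{\lambda_k\tilde p}n\tilde p\xRightarrow{\theta}p\tilde n\xRightarrow{\rho_h\tilde n}p'h\tilde n\big).$$ There are, uniquely up to isomorphism, a morphism $\ell:P\to P'$, a 2-cell $\sigma:\tilde n'\ell\Rightarrow h\tilde n$ and an invertible 2-cell $\tau:k\tilde p\Rightarrow\tilde p'\ell$ whose pasting with the bipullback 2-cell $\theta':n'\tilde p'\Rightarrow p'\tilde n'$ is $\psi$. The composite 2-cell is the isomorphism class $[(\lambda_h\tilde n)(m'\sigma),\ \ell,\ (q'\tau)(\rho_k\tilde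 p)]$. *)

(* Defs.v *)
From Stdlib Require Import ProofIrrelevance ClassicalEpsilon.

Set Implicit Arguments.
Unset Strict Implicit.
Unset Printing Implicit Defensive.

Declare Scope bicat_scope.
Delimit Scope bicat_scope with bicat.

Record category : Type := Category {
  cob :> Type;
  chom : cob -> cob -> Type;
  cid : forall x, chom x x;
  ccomp : forall x y z, chom y z -> chom x y -> chom x z;
  ccompA : forall x y z w (h : chom z w) (g : chom y z) (f : chom x y),
    ccomp (ccomp h g) f = ccomp h (ccomp g f);
  ccomp1l : forall x y (f : chom x y), ccomp (cid y) f = f;
  ccomp1r : forall x y (f : chom x y), ccomp f (cid x) = f
}.
Arguments chom {c} x y.
Arguments cid {c} x.
Arguments ccomp {c x y z} g f.

Definition is_iso (C : category) (x y : C) (f : chom x y) : Prop :=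
  exists g : chom y x, ccomp g f = cid x /\ ccomp f g = cid y.

Lemma is_iso_id (C : category) (x : C) : is_iso (cid x).
Proof. exists (cid x); split; apply ccomp1l. Qed.

Lemma is_iso_comp (C : category) (x y z : C) (g : chom y z) (f : chom x y) :
  is_iso g -> is_iso f -> is_iso (ccomp g f).
Proof.
intros [g' [Hg1 Hg2]] [f' [Hf1 Hf2]]; exists (ccomp f' g'); split.
- rewrite ccompA, <- (ccompA g' g f), Hg1, ccomp1l; exact Hf1.
- rewrite ccompA, <- (ccompA f f' g'), Hf2, ccomp1l; exact Hg2.
Qed.

Record functor (X Y : category) : Type := Functor {
  fob :> X -> Y;
  fhom : forall x y, chom x y -> chom (fob x) (fob y);
  fhom_id : forall x, fhom (cid x) = cid (fob x);
  fhom_comp : forall x y z (g : chom y z) (f : chom x y),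
    fhom (ccomp g f) = ccomp (fhom g) (fhom f)
}.
Arguments fhom {X Y} f {x y} a : rename.

Definition functor_id (X : category) : functor X X :=
  @Functor X X (fun x => x) (fun _ _ f => f) (fun _ => eq_refl)
    (fun _ _ _ _ _ => eq_refl).

Lemma functor_comp_id (X Y Z : category) (G : functor Y Z) (F : functor X Y) x :
  fhom G (fhom F (cid x)) = cid (G (F x)).
Proof. rewrite fhom_id; apply fhom_id. Qed.

Lemma functor_comp_comp (X Y Z : category) (G : functor Y Z) (F : functor X Y)
    (x y z : X) (g : chom y z) (f : chom x y) :
  fhom G (fhom F (ccomp g f)) = ccomp (fhom G (fhom F g)) (fhom G (fhom F f)).
Proof. rewrite fhom_comp; apply fhom_comp. Qed.

Definition functor_comp (X Y Z : category) (G : functor Y Z) (F : functor X Y) :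
    functor X Z :=
  @Functor X Z (fun x => G (F x)) (fun _ _ f => fhom G (fhom F f))
    (functor_comp_id G F) (functor_comp_comp G F).

Definition naturally_isomorphic (X Y : category) (F G : functor X Y) : Prop :=
  exists t : forall x, chom (F x) (G x),
    (forall x, is_iso (t x)) /\
    (forall x y (f : chom x y), ccomp (t y) (fhom F f) = ccomp (fhom G f) (t x)).

Definition is_equivalence (X Y : category) (F : functor X Y) : Prop :=
  exists G : functor Y X,
    naturally_isomorphic (functor_comp G F) (functor_id X) /\
    naturally_isomorphic (functor_comp F G) (functor_id Y).

Section PseudoComma.
Context (X Y Z : category) (F : functor X Z) (G : functor Y Z).

Record psc_ob : Type := PscOb {
  psc_l : X;
  psc_r : Y;
  psc_a : chom (F psc_l) (G psc_r);
  psc_a_iso : is_iso psc_a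
}.

Record psc_hom (a b : psc_ob) : Type := PscHom {
  psc_s : chom (psc_l a) (psc_l b);
  psc_t : chom (psc_r a) (psc_r b);
  psc_sq : ccomp (fhom G psc_t) (psc_a a) = ccomp (psc_a b) (fhom F psc_s)
}.

Lemma psc_hom_eq (a b : psc_ob) (u v : psc_hom a b) :
  psc_s u = psc_s v -> psc_t u = psc_t v -> u = v.
Proof.
destruct u as [s t e], v as [s' t' e']; simpl; intros <- <-.
f_equal; apply proof_irrelevance.
Qed.

Lemma psc_id_sq (a : psc_ob) :
  ccomp (fhom G (cid (psc_r a))) (psc_a a)
  = ccomp (psc_a a) (fhom F (cid (psc_l a))).
Proof. rewrite !fhom_id, ccomp1l, ccomp1r; reflexivity. Qed.

Lemma psc_comp_sq (a b c : psc_ob) (v : psc_hom b c) (u : psc_hom a b) :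
  ccomp (fhom G (ccomp (psc_t v) (psc_t u))) (psc_a a)
  = ccomp (psc_a c) (fhom F (ccomp (psc_s v) (psc_s u))).
Proof.
rewrite !fhom_comp, ccompA, psc_sq, <- ccompA, psc_sq, ccompA; reflexivity.
Qed.

Definition pseudo_comma : category.
Proof.
refine (@Category psc_ob psc_hom (fun a => PscHom (psc_id_sq a))
          (fun a b c v u => PscHom (psc_comp_sq v u)) _ _ _);
  intros; apply psc_hom_eq; simpl;
  first [apply ccompA | apply ccomp1l | apply ccomp1r].
Defined.

End PseudoComma.

Definition set_pullback (P A B C : Type) (a : P -> A) (b : P -> B)
    (f : A -> C) (g : B -> C) : Prop :=
  (forall x, f (a x) = g (b x)) /\
  (forall y z, f y = g z -> exists! x, a x = y /\ b x = z).

Definition is_cartesian (E B : category) (p : functor E B) (e' e : E)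
    (chi : chom e' e) : Prop :=
  forall k : E,
    @set_pullback (chom k e') (chom k e) (chom (p k) (p e')) (chom (p k) (p e))
      (fun f => ccomp chi f) (fun f => fhom p f)
      (fun f => fhom p f) (fun g => ccomp (fhom p chi) g).

Definition is_groupoid_fibration (E B : category) (p : functor E B) : Prop :=
  (forall (e : E) (b : B) (beta : chom b (p e)),
     exists (e' : E) (chi : chom e' e) (i : chom b (p e')),
       is_iso i /\ ccomp (fhom p chi) i = beta) /\
  (forall (e' e : E) (chi : chom e' e), is_cartesian p chi).

(** The objects, 1-cells and 2-cells are separated, together with identity and
    composite 1-cells, from the remaining structure, so that one can speak of
    the bicategory structures on a prescribed frame. *)
Record bicat_frame : Type := BicatFrame {
  ob :> Type;
  mor : ob -> ob -> Type;
  cell : forall X Y, mor X Y -> mor X Y -> Type;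
  id1 : forall X, mor X X;
  comp1 : forall X Y Z, mor Y Z -> mor X Y -> mor X Z
}.
Arguments mor {b} X Y.
Arguments cell {b X Y} f g.
Arguments id1 {b} X.
Arguments comp1 {b X Y Z} g f.

Notation "g ∘ f" := (comp1 g f) (at level 40, left associativity) : bicat_scope.
Notation "f ==> g" := (cell f g) (at level 70) : bicat_scope.
Local Open Scope bicat_scope.

Class bicat_struct (F : bicat_frame) : Type := BicatStruct {
  id2 : forall (X Y : F) (f : mor X Y), f ==> f;
  vcomp : forall (X Y : F) (f g h : mor X Y), g ==> h -> f ==> g -> f ==> h;
  hcomp : forall (X Y Z : F) (g g' : mor Y Z) (f f' : mor X Y),
    g ==> g' -> f ==> f' -> g ∘ f ==> g' ∘ f';
  assoc : forall (X Y Z W : F) (h : mor Z W) (g : mor Y Z) (f : mor X Y),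
    (h ∘ g) ∘ f ==> h ∘ (g ∘ f);
  associ : forall (X Y Z W : F) (h : mor Z W) (g : mor Y Z) (f : mor X Y),
    h ∘ (g ∘ f) ==> (h ∘ g) ∘ f;
  lunit : forall (X Y : F) (f : mor X Y), id1 Y ∘ f ==> f;
  luniti : forall (X Y : F) (f : mor X Y), f ==> id1 Y ∘ f;
  runit : forall (X Y : F) (f : mor X Y), f ∘ id1 X ==> f;
  runiti : forall (X Y : F) (f : mor X Y), f ==> f ∘ id1 X;

  vcompA : forall (X Y : F) (f g h k : mor X Y)
      (c : h ==> k) (b : g ==> h) (a : f ==> g),
    vcomp (vcomp c b) a = vcomp c (vcomp b a);
  vcomp1l : forall (X Y : F) (f g : mor X Y) (a : f ==> g), vcomp (id2 g) a = a;
  vcomp1r : forall (X Y : F) (f g : mor X Y) (a : f ==> g), vcomp a (id2 f) = a;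

  hcomp_id : forall (X Y Z : F) (g : mor Y Z) (f : mor X Y),
    hcomp (id2 g) (id2 f) = id2 (g ∘ f);
  hcomp_vcomp : forall (X Y Z : F) (g g' g'' : mor Y Z) (f f' f'' : mor X Y)
      (b' : g' ==> g'') (b : g ==> g') (a' : f' ==> f'') (a : f ==> f'),
    hcomp (vcomp b' b) (vcomp a' a) = vcomp (hcomp b' a') (hcomp b a);

  assoc_nat : forall (X Y Z W : F) (h h' : mor Z W) (g g' : mor Y Z)
      (f f' : mor X Y) (c : h ==> h') (b : g ==> g') (a : f ==> f'),
    vcomp (assoc h' g' f') (hcomp (hcomp c b) a)
    = vcomp (hcomp c (hcomp b a)) (assoc h g f);
  lunit_nat : forall (X Y : F) (f f' : mor X Y) (a : f ==> f'),
    vcomp (lunit f') (hcomp (id2 (id1 Y)) a) = vcomp a (lunit f);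
  runit_nat : forall (X Y : F) (f f' : mor X Y) (a : f ==> f'),
    vcomp (runit f') (hcomp a (id2 (id1 X))) = vcomp a (runit f);

  associK : forall (X Y Z W : F) (h : mor Z W) (g : mor Y Z) (f : mor X Y),
    vcomp (assoc h g f) (associ h g f) = id2 _;
  assocK : forall (X Y Z W : F) (h : mor Z W) (g : mor Y Z) (f : mor X Y),
    vcomp (associ h g f) (assoc h g f) = id2 _;
  lunitiK : forall (X Y : F) (f : mor X Y), vcomp (lunit f) (luniti f) = id2 _;
  lunitK : forall (X Y : F) (f : mor X Y), vcomp (luniti f) (lunit f) = id2 _;
  runitiK : forall (X Y : F) (f : mor X Y), vcomp (runit f) (runiti f) = id2 _;
  runitK : forall (X Y : F) (f : mor X Y), vcomp (runiti f) (runit f) = id2 _;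

  triangle : forall (X Y Z : F) (g : mor Y Z) (f : mor X Y),
    vcomp (hcomp (id2 g) (lunit f)) (assoc g (id1 Y) f)
    = hcomp (runit g) (id2 f);
  pentagon : forall (X Y Z W V : F) (k : mor W V) (h : mor Z W) (g : mor Y Z)
      (f : mor X Y),
    vcomp (assoc k h (g ∘ f)) (assoc (k ∘ h) g f)
    = vcomp (hcomp (id2 k) (assoc h g f))
        (vcomp (assoc k (h ∘ g) f) (hcomp (assoc k h g) (id2 f)))
}.
Arguments id2 {F _ X Y} f.
Arguments vcomp {F _ X Y f g h} b a.
Arguments hcomp {F _ X Y Z g g' f f'} b a.
Arguments assoc {F _ X Y Z W} h g f.
Arguments associ {F _ X Y Z W} h g f.
Arguments lunit {F _ X Y} f.
Arguments luniti {F _ X Y} f.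
Arguments runit {F _ X Y} f.
Arguments runiti {F _ X Y} f.

Record bicategory : Type := Bicategory {
  bframe :> bicat_frame;
  bstruct : bicat_struct bframe
}.
#[export] Existing Instance bstruct.

Notation "b • a" := (vcomp b a) (at level 41, right associativity) : bicat_scope.
Notation "n ◁ a" := (hcomp (id2 n) a) (at level 39, no associativity) : bicat_scope.
Notation "b ▷ f" := (hcomp b (id2 f)) (at level 39, no associativity) : bicat_scope.

Section Bicategory.
Context (M : bicategory).

Definition hom_cat (X Y : M) : category :=
  @Category (mor X Y) (fun f g => f ==> g) (fun f => id2 f)
    (fun f g h b a => b • a) (@vcompA _ _ X Y) (@vcomp1l _ _ X Y)
    (@vcomp1r _ _ X Y).

Definition invertible (X Y : M) (f g : mor X Y) (a : f ==> g) : Prop :=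
  @is_iso (hom_cat X Y) f g a.

Lemma invertible_id (X Y : M) (f : mor X Y) : invertible (id2 f).
Proof. exact (@is_iso_id (hom_cat X Y) f). Qed.

Lemma invertible_vcomp (X Y : M) (f g h : mor X Y) (b : g ==> h) (a : f ==> g) :
  invertible b -> invertible a -> invertible (b • a).
Proof. exact (@is_iso_comp (hom_cat X Y) f g h b a). Qed.

Lemma invertible_hcomp (X Y Z : M) (g g' : mor Y Z) (f f' : mor X Y)
    (b : g ==> g') (a : f ==> f') :
  invertible b -> invertible a -> invertible (hcomp b a).
Proof.
intros [b' [Hb1 Hb2]] [a' [Ha1 Ha2]]; exists (hcomp b' a'); simpl in *.
rewrite <- !hcomp_vcomp, Hb1, Hb2, Ha1, Ha2, !hcomp_id; split; reflexivity.
Qed.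

Lemma invertible_assoc (X Y Z W : M) (h : mor Z W) (g : mor Y Z) (f : mor X Y) :
  invertible (assoc h g f).
Proof. exists (associ h g f); split; [apply assocK | apply associK]. Qed.

Lemma invertible_associ (X Y Z W : M) (h : mor Z W) (g : mor Y Z) (f : mor X Y) :
  invertible (associ h g f).
Proof. exists (assoc h g f); split; [apply associK | apply assocK]. Qed.

Lemma invertible_runiti (X Y : M) (f : mor X Y) : invertible (runiti f).
Proof. exists (runit f); split; [apply runitiK | apply runitK]. Qed.

Definition equivalence1 (X Y : M) (f : mor X Y) : Prop :=
  exists (g : mor Y X) (eta : id1 X ==> g ∘ f) (eps : f ∘ g ==> id1 Y),
    invertible eta /\ invertible eps.

Definition isomorphic1 (X Y : M) (f g : mor X Y) : Prop :=
  exists a : f ==> g, invertible a.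

Lemma postcomp_id (K E B : M) (p : mor E B) (u : mor K E) :
  p ◁ id2 u = id2 (p ∘ u).
Proof. apply hcomp_id. Qed.

Lemma postcomp_comp (K E B : M) (p : mor E B) (u v w : mor K E)
    (b : v ==> w) (a : u ==> v) :
  p ◁ (b • a) = (p ◁ b) • (p ◁ a).
Proof. rewrite <- hcomp_vcomp, vcomp1l; reflexivity. Qed.

Definition postcomp (K E B : M) (p : mor E B) :
    functor (hom_cat K E) (hom_cat K B) :=
  @Functor (hom_cat K E) (hom_cat K B) (fun u => p ∘ u) (fun u v a => p ◁ a)
    (@postcomp_id K E B p) (@postcomp_comp K E B p).

Definition groupoid_fibration (E B : M) (p : mor E B) : Prop :=
  forall K : M, is_groupoid_fibration (postcomp K p).

Definition right_lifting (K Y Z : M) (n : mor Y Z) (u : mor K Z) (r : mor K Y)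
    (w : n ∘ r ==> u) : Prop :=
  forall (v : mor K Y) (g : n ∘ v ==> u), exists! b : v ==> r, w • (n ◁ b) = g.

Definition right_lifter (Y Z : M) (n : mor Y Z) : Prop :=
  forall (K : M) (u : mor K Z),
    exists (r : mor K Y) (w : n ∘ r ==> u), right_lifting w.

Record square (A B C : M) (n : mor A C) (p : mor B C) : Type := Square {
  sq_apex : M;
  sq_d : mor sq_apex A;
  sq_c : mor sq_apex B;
  sq_theta : n ∘ sq_d ==> p ∘ sq_c;
  sq_theta_inv : invertible sq_theta
}.

(** [sq_whisker s u] is the 2-cell written theta u, with source n(du) and
    target p(cu). *)
Definition sq_whisker (A B C : M) (n : mor A C) (p : mor B C) (s : square n p)
    (K : M) (u : mor K (sq_apex s)) : n ∘ (sq_d s ∘ u) ==> p ∘ (sq_c s ∘ u) :=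
  assoc p (sq_c s) u • (sq_theta s ▷ u) • associ n (sq_d s) u.

Lemma sq_whisker_inv (A B C : M) (n : mor A C) (p : mor B C) (s : square n p)
    (K : M) (u : mor K (sq_apex s)) : invertible (sq_whisker u).
Proof.
repeat apply invertible_vcomp; try apply invertible_hcomp.
- apply invertible_assoc.
- apply sq_theta_inv.
- apply invertible_id.
- apply invertible_associ.
Qed.

Lemma sq_whisker_nat (A B C : M) (n : mor A C) (p : mor B C) (s : square n p)
    (K : M) (u v : mor K (sq_apex s)) (a : u ==> v) :
  (p ◁ (sq_c s ◁ a)) • sq_whisker u = sq_whisker v • (n ◁ (sq_d s ◁ a)).
Proof.
unfold sq_whisker.
assert (E : associ n (sq_d s) v • (n ◁ (sq_d s ◁ a))
            = ((n ∘ sq_d s) ◁ a) • associ n (sq_d s) u).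
{ rewrite <- (vcomp1r (n ◁ (sq_d s ◁ a))).
  rewrite <- (associK n (sq_d s) u).
  rewrite <- (vcompA (n ◁ (sq_d s ◁ a))), <- assoc_nat, hcomp_id.
  rewrite <- !vcompA, assocK, vcomp1l; reflexivity. }
rewrite !vcompA, E, <- (vcompA (p ◁ (sq_c s ◁ a))), <- assoc_nat, hcomp_id.
rewrite !vcompA; f_equal.
rewrite <- !vcompA; f_equal.
rewrite <- !hcomp_vcomp, !vcomp1l, !vcomp1r; reflexivity.
Qed.

Section Comparison.
Context (A B C : M) (n : mor A C) (p : mor B C) (s : square n p) (K : M).

Definition comparison_ob (u : mor K (sq_apex s)) :
    psc_ob (postcomp K n) (postcomp K p) :=
  @PscOb _ _ _ (postcomp K n) (postcomp K p) (sq_d s ∘ u) (sq_c s ∘ u)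
    (sq_whisker u) (sq_whisker_inv u).

Definition comparison_hom (u v : mor K (sq_apex s)) (a : u ==> v) :
    psc_hom (comparison_ob u) (comparison_ob v) :=
  @PscHom _ _ _ (postcomp K n) (postcomp K p) (comparison_ob u) (comparison_ob v)
    (sq_d s ◁ a) (sq_c s ◁ a) (sq_whisker_nat a).

Definition comparison :
  functor (hom_cat K (sq_apex s)) (pseudo_comma (postcomp K n) (postcomp K p)).
Proof.
refine (@Functor (hom_cat K (sq_apex s))
          (pseudo_comma (postcomp K n) (postcomp K p))
          comparison_ob comparison_hom _ _);
  intros; apply psc_hom_eq; simpl;
  first [apply postcomp_id | apply postcomp_comp].
Defined.

End Comparison.

Definition is_bipullback (A B C : M) (n : mor A C) (p : mor B C)
    (s : square n p) : Prop :=
  forall K : M, is_equivalence (comparison s K).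

(** In [cal_bipb], [sq_d s] is the projection to the source of the right lifter
    n, and [sq_c s] the projection to the source of the neat p. *)
Record calibration (neat : forall X Y : M, mor X Y -> Prop) : Prop := Calibration {
  cal_equiv : forall (X Y : M) (f : mor X Y), equivalence1 f -> neat X Y f;
  cal_iso : forall (X Y : M) (f g : mor X Y),
    isomorphic1 f g -> neat X Y f -> neat X Y g;
  cal_comp : forall (X Y Z : M) (p : mor Y Z) (q : mor X Y),
    neat Y Z p -> (neat X Z (p ∘ q) <-> neat X Y q);
  cal_fib : forall (X Y : M) (p : mor X Y), neat X Y p -> groupoid_fibration p;
  cal_bipb : forall (T S Y : M) (n : mor T Y) (p : mor S Y),
    right_lifter n -> neat S Y p ->
    exists s : square n p, is_bipullback s /\ neat (sq_apex s) T (sq_d s)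
}.

(** The composite of polynomials depends on which bipullbacks are used; choices
    exist for every calibration by [bipullback_choice_exists]. *)
Record bipullback_choice (neat : forall X Y : M, mor X Y -> Prop) : Type :=
  BipullbackChoice {
  chosen : forall (T S Y : M) (n : mor T Y) (p : mor S Y),
    right_lifter n -> neat S Y p -> square n p;
  chosen_bipb : forall (T S Y : M) (n : mor T Y) (p : mor S Y)
    (Hn : right_lifter n) (Hp : neat S Y p), is_bipullback (chosen Hn Hp);
  chosen_neat : forall (T S Y : M) (n : mor T Y) (p : mor S Y)
    (Hn : right_lifter n) (Hp : neat S Y p), neat _ _ (sq_d (chosen Hn Hp))
}.

Lemma bipullback_choice_exists (neat : forall X Y : M, mor X Y -> Prop) :
  calibration neat -> inhabited (bipullback_choice neat).
Proof.
intros cal.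
pose (c := fun (T S Y : M) (n : mor T Y) (p : mor S Y)
             (Hn : right_lifter n) (Hp : neat S Y p) =>
           constructive_indefinite_description _ (cal_bipb cal Hn Hp)).
constructor.
exists (fun T S Y n p Hn Hp => proj1_sig (c T S Y n p Hn Hp)); intros;
  apply (proj2_sig (c T S Y n p Hn Hp)).
Qed.

Record span (X Y : M) : Type := Span {
  apex : M;
  lleg : mor apex X;
  rleg : mor apex Y
}.

(** Polynomial morphisms between polynomials depend only on the underlying
    spans. *)
Record pmor (X Y : M) (f f' : span X Y) : Type := Pmor {
  pm_h : mor (apex f) (apex f');
  pm_lambda : lleg f' ∘ pm_h ==> lleg f;
  pm_rho : rleg f ==> rleg f' ∘ pm_h;
  pm_rho_inv : invertible pm_rho
}.

Definition is_pmor_cell (X Y : M) (f f' : span X Y) (x y : pmor f f')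
    (s : pm_h x ==> pm_h y) : Prop :=
  pm_lambda x = pm_lambda y • (lleg f' ◁ s) /\
  pm_rho y = (rleg f' ◁ s) • pm_rho x.

Definition pmor_isomorphic (X Y : M) (f f' : span X Y) (x y : pmor f f') : Prop :=
  exists s : pm_h x ==> pm_h y, invertible s /\ is_pmor_cell s.

(** Isomorphism classes, as sets of polynomial morphisms. *)
Record pcell (X Y : M) (f f' : span X Y) : Type := Pcell {
  pcell_mem : pmor f f' -> Prop;
  pcell_class : exists x, forall y, pcell_mem y <-> pmor_isomorphic x y
}.

Definition cls (X Y : M) (f f' : span X Y) (x : pmor f f') : pcell f f' :=
  Pcell (ex_intro _ x (fun y => iff_refl (pmor_isomorphic x y))).

Definition pmor_id (X Y : M) (f : span X Y) : pmor f f :=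
  @Pmor X Y f f (id1 (apex f)) (runit (lleg f)) (runiti (rleg f))
    (invertible_runiti _).

Lemma pmor_comp_inv (X Y : M) (f f' f'' : span X Y)
    (y : pmor f' f'') (x : pmor f f') :
  invertible (assoc (rleg f'') (pm_h y) (pm_h x) • (pm_rho y ▷ pm_h x) • pm_rho x).
Proof.
repeat apply invertible_vcomp; try apply invertible_hcomp;
  auto using invertible_assoc, invertible_id, pm_rho_inv.
Qed.

Definition pmor_comp (X Y : M) (f f' f'' : span X Y)
    (y : pmor f' f'') (x : pmor f f') : pmor f f'' :=
  @Pmor X Y f f'' (pm_h y ∘ pm_h x)
    (pm_lambda x • (pm_lambda y ▷ pm_h x) • associ (lleg f'') (pm_h y) (pm_h x))
    (assoc (rleg f'') (pm_h y) (pm_h x) • (pm_rho y ▷ pm_h x) • pm_rho x)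
    (pmor_comp_inv y x).

Definition id_span (X : M) : span X X := Span (id1 X) (id1 X).

Definition square_span (X S Y T Z : M) (m : mor S X) (p : mor S Y)
    (n : mor T Y) (q : mor T Z) (s : square n p) : span X Z :=
  Span (m ∘ sq_c s) (q ∘ sq_d s).

Section Fill.
Context (X Y Z : M) (f f' : span X Y) (g g' : span Y Z).
Context (s : square (lleg g) (rleg f)) (s' : square (lleg g') (rleg f')).
Context (y : pmor g g') (x : pmor f f').

Definition fill_psi :
    (lleg g' ∘ pm_h y) ∘ sq_d s ==> (rleg f' ∘ pm_h x) ∘ sq_c s :=
  (pm_rho x ▷ sq_c s) • sq_theta s • (pm_lambda y ▷ sq_d s).

(** [fl_eq] says that pasting [fl_sigma] and [fl_tau] onto the 2-cell of [s'] gives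
    [fill_psi]; only [fl_tau] is required to be invertible. *)
Record filler : Type := Filler {
  fl_l : mor (sq_apex s) (sq_apex s');
  fl_sigma : sq_c s' ∘ fl_l ==> pm_h x ∘ sq_c s;
  fl_tau : pm_h y ∘ sq_d s ==> sq_d s' ∘ fl_l;
  fl_tau_inv : invertible fl_tau;
  fl_eq : (rleg f' ◁ fl_sigma) • sq_whisker fl_l • (lleg g' ◁ fl_tau)
            • assoc (lleg g') (pm_h y) (sq_d s)
          = assoc (rleg f') (pm_h x) (sq_c s) • fill_psi
}.

Lemma filler_pmor_inv (d : filler) :
  invertible (associ (rleg g') (sq_d s') (fl_l d) • (rleg g' ◁ fl_tau d)
    • assoc (rleg g') (pm_h y) (sq_d s) • (pm_rho y ▷ sq_d s)).
Proof.
repeat apply invertible_vcomp; try apply invertible_hcomp;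
  auto using invertible_assoc, invertible_associ, invertible_id, pm_rho_inv,
    fl_tau_inv.
Qed.

Definition filler_pmor (d : filler) :
    pmor (square_span (lleg f) (rleg g) s) (square_span (lleg f') (rleg g') s') :=
  @Pmor X Z (square_span (lleg f) (rleg g) s) (square_span (lleg f') (rleg g') s')
    (fl_l d)
    ((pm_lambda x ▷ sq_c s) • associ (lleg f') (pm_h x) (sq_c s)
       • (lleg f' ◁ fl_sigma d) • assoc (lleg f') (sq_c s') (fl_l d))
    (associ (rleg g') (sq_d s') (fl_l d) • (rleg g' ◁ fl_tau d)
       • assoc (rleg g') (pm_h y) (sq_d s) • (pm_rho y ▷ sq_d s))
    (filler_pmor_inv d).

End Fill.

Section HStack.
Context (A' A B C : M) (n : mor A C) (p : mor B C) (k : mor A' A).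
Context (s : square n p) (w : square k (sq_d s)).

Definition hstack_theta : (n ∘ k) ∘ sq_d w ==> p ∘ (sq_c s ∘ sq_c w) :=
  sq_whisker (sq_c w) • (n ◁ sq_theta w) • assoc n k (sq_d w).

Lemma hstack_theta_inv : invertible hstack_theta.
Proof.
apply invertible_vcomp; [apply sq_whisker_inv | apply invertible_vcomp];
  auto using invertible_assoc, invertible_hcomp, invertible_id, sq_theta_inv.
Qed.

Definition hstack : square (n ∘ k) p :=
  @Square A' B C (n ∘ k) p (sq_apex w) (sq_d w) (sq_c s ∘ sq_c w)
    hstack_theta hstack_theta_inv.

End HStack.

Section VStack.
Context (U T A Z : M) (r : mor U Z) (q : mor T Z) (t : mor A T).
Context (s : square r q) (w : square (sq_c s) t).

Definition vstack_theta : r ∘ (sq_d s ∘ sq_d w) ==> (q ∘ t) ∘ sq_c w :=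
  associ q t (sq_c w) • (q ◁ sq_theta w) • sq_whisker (sq_d w).

Lemma vstack_theta_inv : invertible vstack_theta.
Proof.
apply invertible_vcomp; [apply invertible_associ | apply invertible_vcomp];
  auto using invertible_hcomp, invertible_id, sq_whisker_inv, sq_theta_inv.
Qed.

Definition vstack : square r (q ∘ t) :=
  @Square U A Z r (q ∘ t) (sq_apex w) (sq_d s ∘ sq_d w) (sq_c w)
    vstack_theta vstack_theta_inv.

End VStack.

(** Comparison of two squares on the same cospan. When the target is a
    bipullback, such a map exists and is unique up to isomorphism. *)
Record square_map (A B C : M) (n : mor A C) (p : mor B C) (s s' : square n p) :
    Type := SquareMap {
  sm_l : mor (sq_apex s) (sq_apex s');
  sm_sigma : sq_c s' ∘ sm_l ==> sq_c s;
  sm_tau : sq_d s ==> sq_d s' ∘ sm_l;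
  sm_sigma_inv : invertible sm_sigma;
  sm_tau_inv : invertible sm_tau;
  sm_eq : (p ◁ sm_sigma) • sq_whisker sm_l • (n ◁ sm_tau) = sq_theta s
}.

Section SquareMapPmor.
Context (X S Y T Z : M) (m : mor S X) (p : mor S Y) (n : mor T Y) (q : mor T Z).
Context (s s' : square n p) (e : square_map s s').

Lemma square_map_pmor_inv :
  invertible (associ q (sq_d s') (sm_l e) • (q ◁ sm_tau e)).
Proof.
repeat apply invertible_vcomp; try apply invertible_hcomp;
  auto using invertible_associ, invertible_id, sm_tau_inv.
Qed.

Definition square_map_pmor : pmor (square_span m q s) (square_span m q s') :=
  @Pmor X Z (square_span m q s) (square_span m q s') (sm_l e)
    ((m ◁ sm_sigma e) • assoc m (sq_c s') (sm_l e))
    (associ q (sq_d s') (sm_l e) • (q ◁ sm_tau e))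
    square_map_pmor_inv.

End SquareMapPmor.

Section Rebracket.
Context (X Z W S P R U : M) (m : mor S X) (c : mor P S) (c' : mor W P).
Context (t : mor U Z) (d' : mor R U) (d : mor W R).

Lemma rebracket_inv : invertible (runiti (t ∘ (d' ∘ d)) • assoc t d' d).
Proof. apply invertible_vcomp; auto using invertible_runiti, invertible_assoc. Qed.

Definition rebracket :
    pmor (Span (m ∘ (c ∘ c')) ((t ∘ d') ∘ d)) (Span ((m ∘ c) ∘ c') (t ∘ (d' ∘ d))) :=
  @Pmor X Z (Span (m ∘ (c ∘ c')) ((t ∘ d') ∘ d))
    (Span ((m ∘ c) ∘ c') (t ∘ (d' ∘ d)))
    (id1 W) (assoc m c c' • runit ((m ∘ c) ∘ c'))
    (runiti (t ∘ (d' ∘ d)) • assoc t d' d)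
    rebracket_inv.

End Rebracket.

(** For spans f = (m, S, p), g = (n, T, q), h = (r, U, t) and squares
    [P] on (n, p), [R] on (r, q), [V] on (n c_R, p), [Q] on (r, q d_P), the
    apices of [V] and [Q] are those of (h g) f and h (g f).  A stacking consists
    of a bipullback W of (c_R, d_P), whose horizontal stacking with [P] and
    vertical stacking with [R] are squares on the cospans of [V] and of [Q],
    together with the induced comparisons V -> W -> Q. *)
Section Stacking.
Context (X Y Z W : M) (f : span X Y) (g : span Y Z) (h : span Z W).
Context (P : square (lleg g) (rleg f)) (R : square (lleg h) (rleg g)).
Context (V : square (lleg g ∘ sq_c R) (rleg f)).
Context (Q : square (lleg h) (rleg g ∘ sq_d P)).

Record stacking : Type := Stacking {
  st_sq : square (sq_c R) (sq_d P);
  st_bipb : is_bipullback st_sq;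
  st_h : square_map V (hstack st_sq);
  st_v : square_map (vstack st_sq) Q
}.

Definition stacking_pmor (w : stacking) :
    pmor (square_span (lleg f) (rleg h ∘ sq_d R) V)
         (square_span (lleg f ∘ sq_c P) (rleg h) Q) :=
  pmor_comp (square_map_pmor (lleg f ∘ sq_c P) (rleg h) (st_v w))
    (pmor_comp
       (rebracket (lleg f) (sq_c P) (sq_c (st_sq w))
                  (rleg h) (sq_d R) (sq_d (st_sq w)))
       (square_map_pmor (lleg f) (rleg h ∘ sq_d R) (st_h w))).

End Stacking.
Arguments stacking {X Y Z W f g h} P R V Q.

Context (neat : forall X Y : M, mor X Y -> Prop).
Arguments neat {X Y} _.

Record is_polynomial (X Y : M) (f : span X Y) : Prop := IsPolynomial {
  poly_lifter : right_lifter (lleg f);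
  poly_neat : neat (rleg f)
}.

Record polynomial (X Y : M) : Type := Polynomial {
  poly_span :> span X Y;
  poly_is :> is_polynomial poly_span
}.

Context (ch : bipullback_choice (@neat)).

Definition comp_square (X Y Z : M) (g : polynomial Y Z) (f : polynomial X Y) :
    square (lleg g) (rleg f) :=
  chosen ch (poly_lifter g) (poly_neat f).

Definition comp_span (X Y Z : M) (g : polynomial Y Z) (f : polynomial X Y) :
    span X Z :=
  square_span (lleg f) (rleg g) (comp_square g f).

Section PolyBicategory.
Context (Hid : forall X : M, is_polynomial (id_span X)).
Context (Hcomp : forall (X Y Z : M) (g : polynomial Y Z) (f : polynomial X Y),
  is_polynomial (comp_span g f)).

Definition poly_frame : bicat_frame :=
  @BicatFrame M polynomial (fun X Y f f' => pcell f f')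
    (fun X => Polynomial (Hid X))
    (fun X Y Z g f => Polynomial (Hcomp g f)).

Context (PolyM : bicat_struct poly_frame).

(** The next three conditions prescribe the vertical composition, the composition
    functors and the associativity isomorphisms of [PolyM] on arbitrary
    representatives; its unit isomorphisms are left free. *)

Definition poly_homcategories : Prop :=
  (forall (X Y : M) (f : polynomial X Y),
     @id2 poly_frame PolyM X Y f = cls (pmor_id f)) /\
  (forall (X Y : M) (f f' f'' : polynomial X Y) (y : pmor f' f'') (x : pmor f f'),
     @vcomp poly_frame PolyM X Y f f' f'' (cls y) (cls x) = cls (pmor_comp y x)).

Definition poly_composition : Prop :=
  forall (X Y Z : M) (f f' : polynomial X Y) (g g' : polynomial Y Z)
    (y : pmor g g') (x : pmor f f'),
  inhabited (filler (comp_square g f) (comp_square g' f') y x) /\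
  forall d : filler (comp_square g f) (comp_square g' f') y x,
    @hcomp poly_frame PolyM X Y Z g g' f f' (cls y) (cls x) = cls (filler_pmor d).

Definition poly_associativity : Prop :=
  forall (X Y Z W : M) (f : polynomial X Y) (g : polynomial Y Z)
    (h : polynomial Z W),
  let P := comp_square g f in
  let R := comp_square h g in
  let V := comp_square (Polynomial (Hcomp h g)) f in
  let Q := comp_square h (Polynomial (Hcomp g f)) in
  inhabited (stacking P R V Q) /\
  forall w : stacking P R V Q,
    @assoc poly_frame PolyM X Y Z W h g f = cls (stacking_pmor w).

End PolyBicategory.

End Bicategory.

Arguments calibration {M} neat.
Arguments bipullback_choice {M} neat.
Arguments is_polynomial {M} neat {X Y} f.
Arguments polynomial {M} neat X Y.

(* Main.v *)
From Stdlib Require Import RelationClasses FunctionalExtensionality PropExtensionality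
  ProofIrrelevance ClassicalEpsilon.
From Stdlib Require Morphisms Setoid.
Require Import Defs.

(** A span (m, S, p) acts, for every object K, on set-valued functors T on M(K, Y)
    by (Phi T)(b) = colim over s in M(K, S) of M(K, X)(m s, b) * T(p s), the left
    Kan extension along m of the restriction of T along p.  For a neat p, the
    polynomial morphisms w -> (m, S, p) up to isomorphism are the elements of
    Phi(M(K, Y)(c, -))(a), where w = (a, K, c): a non-invertible 2-cell c => p s is
    made invertible by a cartesian lift.  Hence 2-cells of polynomials are
    determined by the natural maps they induce between the Phi's.  Because a
    bipullback along a groupoid fibration has the lax universal property
    [lax_universal], the functor attached to a composite is the composite of the
    functors attached to the factors ([expand]).  Under these bijections the
    horizontal composition, associators and unitors of Poly M become those of
    composition of functors, so all bicategory axioms hold. *)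

Set Implicit Arguments.
Unset Strict Implicit.
Unset Printing Implicit Defensive.
Local Open Scope bicat_scope.

(** * Coherence in a bicategory *)

Section Coherence.
Context (M : bicategory).

Lemma whiskerR_vcomp (X Y Z : M) (g g' g'' : mor Y Z) (f : mor X Y)
    (b : g' ==> g'') (a : g ==> g') :
  (b • a) ▷ f = (b ▷ f) • (a ▷ f).
Proof. rewrite <- hcomp_vcomp, vcomp1l; reflexivity. Qed.

Lemma whisker_exchange (X Y Z : M) (g g' : mor Y Z) (f f' : mor X Y)
    (b : g ==> g') (a : f ==> f') :
  (b ▷ f') • (g ◁ a) = (g' ◁ a) • (b ▷ f).
Proof. rewrite <- !hcomp_vcomp, !vcomp1l, !vcomp1r; reflexivity. Qed.

Lemma assocK_l (X Y Z W : M) (h : mor Z W) (g : mor Y Z) (f : mor X Y) k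
    (a : k ==> (h ∘ g) ∘ f) :
  associ h g f • assoc h g f • a = a.
Proof. rewrite <- vcompA, assocK; apply vcomp1l. Qed.

Lemma associK_l (X Y Z W : M) (h : mor Z W) (g : mor Y Z) (f : mor X Y) k
    (a : k ==> h ∘ (g ∘ f)) :
  assoc h g f • associ h g f • a = a.
Proof. rewrite <- vcompA, associK; apply vcomp1l. Qed.

Lemma whiskerL_cancel (X Y Z : M) (n : mor Y Z) (f g : mor X Y)
    (b : g ==> f) (a : f ==> g) :
  b • a = id2 f -> (n ◁ b) • (n ◁ a) = id2 (n ∘ f).
Proof. intros E; rewrite <- postcomp_comp, E; apply hcomp_id. Qed.

Lemma whiskerL_cancel_l (X Y Z : M) (n : mor Y Z) (f g : mor X Y) k
    (b : g ==> f) (a : f ==> g) (c : k ==> n ∘ f) :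
  b • a = id2 f -> (n ◁ b) • (n ◁ a) • c = c.
Proof. intros E; rewrite <- vcompA, whiskerL_cancel by exact E; apply vcomp1l. Qed.

Lemma whiskerR_whiskerL (X Y Z W : M) (n : mor Z W) (g g' : mor Y Z) (w : mor X Y)
    (a : g ==> g') :
  (n ◁ a) ▷ w = associ n g' w • (n ◁ (a ▷ w)) • assoc n g w.
Proof. rewrite <- assoc_nat, assocK_l; reflexivity. Qed.

Lemma whiskerR_whiskerR (X Y Z W : M) (g g' : mor Z W) (f : mor Y Z) (w : mor X Y)
    (a : g ==> g') :
  (a ▷ f) ▷ w = associ g' f w • (a ▷ (f ∘ w)) • assoc g f w.
Proof. rewrite <- hcomp_id, <- assoc_nat, assocK_l; reflexivity. Qed.

Lemma associ_natL (X Y Z W : M) (n : mor Z W) (m : mor Y Z) (f f' : mor X Y)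
    (a : f ==> f') :
  associ n m f' • (n ◁ (m ◁ a)) = ((n ∘ m) ◁ a) • associ n m f.
Proof.
rewrite <- (vcomp1r (n ◁ (m ◁ a))), <- (associK n m f).
rewrite <- (vcompA (n ◁ (m ◁ a))), <- assoc_nat, hcomp_id, vcompA.
apply assocK_l.
Qed.

Lemma assoc_natL (X Y Z W : M) (n : mor Z W) (m : mor Y Z) (f f' : mor X Y)
    (a : f ==> f') :
  assoc n m f' • ((n ∘ m) ◁ a) = (n ◁ (m ◁ a)) • assoc n m f.
Proof. rewrite <- assoc_nat, hcomp_id; reflexivity. Qed.

Lemma whiskerR_assoc (X Y Z W V : M) (k : mor W V) (h : mor Z W) (g : mor Y Z)
    (f : mor X Y) :
  assoc k h g ▷ f
  = associ k (h ∘ g) f • (k ◁ associ h g f) • assoc k h (g ∘ f) • assoc (k ∘ h) g f.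
Proof.
rewrite pentagon, whiskerL_cancel_l by apply assocK.
rewrite assocK_l; reflexivity.
Qed.

Lemma whiskerR_cancel (X Y Z : M) (f g : mor Y Z) (w : mor X Y)
    (b : g ==> f) (a : f ==> g) :
  b • a = id2 f -> (b ▷ w) • (a ▷ w) = id2 (f ∘ w).
Proof. intros E; rewrite <- whiskerR_vcomp, E; apply hcomp_id. Qed.

Lemma inverse_unique (X Y : M) (f g : mor X Y) (a : f ==> g) (b b' : g ==> f) :
  b • a = id2 f -> a • b' = id2 g -> b = b'.
Proof. intros E E'; rewrite <- (vcomp1r b), <- E', <- vcompA, E; apply vcomp1l. Qed.

Lemma whiskerR_associ (X Y Z W V : M) (k : mor W V) (h : mor Z W) (g : mor Y Z)
    (f : mor X Y) :
  associ k h g ▷ f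
  = associ (k ∘ h) g f • associ k h (g ∘ f) • (k ◁ assoc h g f) • assoc k (h ∘ g) f.
Proof.
apply (inverse_unique (a := assoc k h g ▷ f)).
- apply whiskerR_cancel, assocK.
- rewrite whiskerR_assoc, !vcompA, associK_l, associK_l.
  rewrite whiskerL_cancel_l by apply assocK. apply assocK.
Qed.

Lemma whiskerR_runit (X Y Z : M) (g : mor Y Z) (f : mor X Y) :
  runit g ▷ f = (g ◁ lunit f) • assoc g (id1 Y) f.
Proof. symmetry; apply triangle. Qed.

Lemma whiskerR_id1_inj (X Y : M) (f f' : mor X Y) (a b : f ==> f') :
  a ▷ id1 X = b ▷ id1 X -> a = b.
Proof.
intros E; rewrite <- (vcomp1r a), <- (vcomp1r b), <- runitiK, <- !vcompA.
rewrite <- !runit_nat, E; reflexivity.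
Qed.

(** The classical consequence of pentagon and triangle: after whiskering with [id1 X], both sides
    reduce to [lunit] by the triangle, and the pentagon compares them. *)
Lemma runit_comp (X Y Z : M) (g : mor Y Z) (f : mor X Y) :
  (g ◁ runit f) • assoc g f (id1 X) = runit (g ∘ f).
Proof.
apply whiskerR_id1_inj.
rewrite whiskerR_vcomp, whiskerR_whiskerL, !whiskerR_runit, whiskerR_assoc.
rewrite !vcompA, associK_l, postcomp_comp, vcompA.
rewrite whiskerL_cancel_l by apply associK.
rewrite <- (vcompA _ (assoc g f _)), <- assoc_natL, vcompA, assocK_l.
reflexivity.
Qed.

End Coherence.

(** * Normalization of pasted 2-cells *)

Ltac cell_rule t :=
  lazymatch t with
  | hcomp (id2 ?g) (id2 ?f) => constr:(hcomp_id g f)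
  | hcomp (vcomp ?b ?a) (id2 ?f) => constr:(whiskerR_vcomp f b a)
  | hcomp (assoc ?k ?h ?g) (id2 ?f) => constr:(whiskerR_assoc k h g f)
  | hcomp (associ ?k ?h ?g) (id2 ?f) => constr:(whiskerR_associ k h g f)
  | hcomp (hcomp (id2 ?g) (id2 ?f)) (id2 ?w) =>
      constr:(f_equal (fun z => hcomp z (id2 w)) (hcomp_id g f))
  | hcomp (hcomp (id2 ?n) ?a) (id2 ?w) => constr:(whiskerR_whiskerL n w a)
  | hcomp (hcomp ?a (id2 ?f)) (id2 ?w) => constr:(whiskerR_whiskerR f w a)
  | hcomp (id2 ?n) (vcomp ?b ?a) => constr:(postcomp_comp n b a)
  | hcomp (id2 ?n) ?a =>
      let e := cell_rule a in constr:(f_equal (fun z => hcomp (id2 n) z) e)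
  end.

Ltac cancel_head :=
  lazymatch goal with
  | |- vcomp ?b (id2 _) = _ => exact (vcomp1r b)
  | |- vcomp (assoc ?h ?g ?f) (vcomp (associ _ _ _) ?a) = _ =>
      exact (associK_l (h := h) (g := g) (f := f) a)
  | |- vcomp (associ ?h ?g ?f) (vcomp (assoc _ _ _) ?a) = _ =>
      exact (assocK_l (h := h) (g := g) (f := f) a)
  | |- vcomp (assoc ?h ?g ?f) (associ _ _ _) = _ => exact (associK h g f)
  | |- vcomp (associ ?h ?g ?f) (assoc _ _ _) = _ => exact (assocK h g f)
  | |- vcomp (hcomp (id2 ?n) (assoc ?h ?g ?f))
         (vcomp (hcomp (id2 _) (associ _ _ _)) ?a) = _ =>
      exact (whiskerL_cancel_l (n := n) a (associK h g f))
  | |- vcomp (hcomp (id2 ?n) (associ ?h ?g ?f))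
         (vcomp (hcomp (id2 _) (assoc _ _ _)) ?a) = _ =>
      exact (whiskerL_cancel_l (n := n) a (assocK h g f))
  | |- vcomp (hcomp (id2 ?n) (assoc ?h ?g ?f)) (hcomp (id2 _) (associ _ _ _)) = _ =>
      exact (whiskerL_cancel n (associK h g f))
  | |- vcomp (hcomp (id2 ?n) (associ ?h ?g ?f)) (hcomp (id2 _) (assoc _ _ _)) = _ =>
      exact (whiskerL_cancel n (assocK h g f))
  | |- _ => reflexivity
  end.

(** On a goal [a = ?b], pushes whiskering inwards in [a], nests vertical
    composites to the right and cancels adjacent inverse associators. *)
Ltac normalize_cell :=
  lazymatch goal with
  | |- vcomp (vcomp ?c ?b) ?a = _ =>
      refine (eq_trans (vcompA c b a) _); normalize_cell
  | |- vcomp (id2 _) ?a = _ => refine (eq_trans (vcomp1l a) _); normalize_cell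
  | |- vcomp ?b ?a = _ =>
      tryif (let e := cell_rule b in
             refine (eq_trans (f_equal (fun z => vcomp z a) e) _); cbv beta)
      then normalize_cell
      else (refine (eq_trans (f_equal (fun z => vcomp b z) _) _);
            [normalize_cell | cbv beta; cancel_head])
  | |- ?b = _ =>
      tryif (let e := cell_rule b in refine (eq_trans e _); cbv beta)
      then normalize_cell else reflexivity
  end.

(** Replaces both sides of an equation by their normal forms; the remaining goal has its sides
    exchanged. *)
Ltac coh :=
  etransitivity; [normalize_cell | symmetry; etransitivity; [normalize_cell|]].

(** * Bipullbacks along groupoid fibrations *)

(** Conjugating [fhom G (fhom F a)] by the isomorphism from GF to the identity gives back [a]. *)
Lemma faithful_of_retract (X Y : category) (F : functor X Y) (G : functor Y X) :
  naturally_isomorphic (functor_comp G F) (functor_id X) ->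
  forall x y (a b : chom x y), fhom F a = fhom F b -> a = b.
Proof.
intros [t [Ht Hn]] x y a b E.
destruct (Ht x) as [u [_ Hu]].
pose proof (Hn _ _ a) as Ea; pose proof (Hn _ _ b) as Eb; simpl in *.
rewrite <- (ccomp1r a), <- (ccomp1r b), <- Hu, <- !ccompA, <- Ea, <- Eb, E.
reflexivity.
Qed.

Lemma equivalence_full (X Y : category) (F : functor X Y) : is_equivalence F ->
  forall x y (b : chom (F x) (F y)), exists a, fhom F a = b.
Proof.
intros [G [GF FG]] x y b.
destruct GF as [t [Ht Hn]].
destruct (Ht x) as [u [Hu _]], (Ht y) as [v [Hv _]].
exists (ccomp (t y) (ccomp (fhom G b) u)).
(* [G] is faithful as well, so it suffices to compare after applying [G]. *)
apply (faithful_of_retract FG).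
set (a := ccomp (t y) _).
pose proof (Hn _ _ a) as Ea; simpl in *.
rewrite <- (ccomp1l (fhom G (fhom F a))), <- Hv, ccompA, Ea; unfold a.
rewrite !ccompA, Hu, ccomp1r, <- ccompA, Hv; apply ccomp1l.
Qed.

Section Bipullbacks.
Context (M : bicategory).

(** Since [a] is cartesian, the inverse of its image lifts to a right inverse [c]; uniqueness of
    lifts through [a] then forces [c • a] to be the identity. *)
Lemma invertible_conservative (E B : M) (p : mor E B) (K : M) (u v : mor K E)
    (a : u ==> v) :
  groupoid_fibration p -> invertible (p ◁ a) -> invertible a.
Proof.
intros Hp [b [Hb Hb']]; simpl in *.
destruct (Hp K) as [_ cart].
destruct (cart _ _ a v) as [_ ca]; simpl in ca.
destruct (ca (id2 v) b) as [c [[Hc Hc'] _]].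
{ rewrite Hb'; apply hcomp_id. }
exists c; simpl; split; [|exact Hc].
destruct (cart _ _ a u) as [_ cu]; simpl in cu.
destruct (cu a (id2 (p ∘ u))) as [d [_ Hd]].
{ symmetry; apply vcomp1r. }
transitivity d; [symmetry|]; apply Hd; split.
- rewrite <- vcompA, Hc; apply vcomp1l.
- rewrite postcomp_comp, Hc'; exact Hb.
- apply vcomp1r.
- apply hcomp_id.
Qed.

Lemma cartesian_lift (E B : M) (p : mor E B) (K : M) (e' e : mor K E)
    (chi : e' ==> e) (k : mor K E) (a : k ==> e) (b : p ∘ k ==> p ∘ e') :
  groupoid_fibration p -> p ◁ a = (p ◁ chi) • b ->
  exists! c : k ==> e', chi • c = a /\ p ◁ c = b.
Proof.
intros Hp E'; destruct (Hp K) as [_ cart].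
destruct (cart _ _ chi k) as [_ H]; exact (H a b E').
Qed.

Context (A B C : M) (n : mor A C) (p : mor B C) (s : square n p).
Context (Hs : is_bipullback s).

(** Full faithfulness of the comparison functor, in components. *)
Lemma bipullback_hom (K : M) (c c' : mor K (sq_apex s))
    (k : sq_d s ∘ c ==> sq_d s ∘ c') (x : sq_c s ∘ c ==> sq_c s ∘ c') :
  (p ◁ x) • sq_whisker c = sq_whisker c' • (n ◁ k) ->
  exists! a : c ==> c', sq_d s ◁ a = k /\ sq_c s ◁ a = x.
Proof.
intros E.
destruct (equivalence_full (Hs K) (x := c) (y := c')
  (@PscHom _ _ _ (postcomp K n) (postcomp K p) (comparison_ob c)
     (comparison_ob c') k x E)) as [a Ha].
exists a; split.
- split; [exact (f_equal (@psc_s _ _ _ _ _ _ _) Ha)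
         | exact (f_equal (@psc_t _ _ _ _ _ _ _) Ha)].
- intros a' [Hd Hc]; destruct (Hs K) as [G [GF _]].
  apply (faithful_of_retract GF); rewrite Ha; apply psc_hom_eq; simpl; auto.
Qed.

(** Essential surjectivity of the comparison functor, in components. *)
Lemma bipullback_ob (K : M) (u : mor K A) (v : mor K B) (th : n ∘ u ==> p ∘ v) :
  invertible th ->
  exists (c : mor K (sq_apex s)) (k : sq_d s ∘ c ==> u) (x : sq_c s ∘ c ==> v),
    invertible k /\ invertible x /\ (p ◁ x) • sq_whisker c = th • (n ◁ k).
Proof.
intros Hth; destruct (Hs K) as [G [_ [t [Ht _]]]].
pose (y := @PscOb _ _ _ (postcomp K n) (postcomp K p) u v th Hth).
exists (G y), (psc_s (t y)), (psc_t (t y)).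
destruct (Ht y) as [b [Hb Hb']].
split; [|split].
- exists (psc_s b); split; [exact (f_equal (@psc_s _ _ _ _ _ _ _) Hb)
         | exact (f_equal (@psc_s _ _ _ _ _ _ _) Hb')].
- exists (psc_t b); split; [exact (f_equal (@psc_t _ _ _ _ _ _ _) Hb)
         | exact (f_equal (@psc_t _ _ _ _ _ _ _) Hb')].
- exact (psc_sq (t y)).
Qed.

(** A bipullback along a groupoid fibration is also universal among squares
    whose 2-cell is not invertible: factor that 2-cell through a cartesian lift. *)
Lemma lax_universal (Hp : groupoid_fibration p) (K : M) (u : mor K A) (v : mor K B)
    (th : n ∘ u ==> p ∘ v) :
  exists (c : mor K (sq_apex s)) (k : sq_d s ∘ c ==> u) (x : sq_c s ∘ c ==> v),
    invertible k /\ (p ◁ x) • sq_whisker c = th • (n ◁ k) /\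
     forall (c' : mor K (sq_apex s)) (k' : sq_d s ∘ c' ==> u)
       (x' : sq_c s ∘ c' ==> v),
       (p ◁ x') • sq_whisker c' = th • (n ◁ k') ->
       exists! a : c' ==> c, k • (sq_d s ◁ a) = k' /\ x • (sq_c s ◁ a) = x'.
Proof.
destruct (Hp K) as [lift _].
(* [th] is an invertible [i] followed by the image of [chi]. The bipullback is applied to [i], and
   [chi] is then attached to the second leg. *)
destruct (lift v (n ∘ u) th) as [v0 [chi [i [Hi Ei]]]]; simpl in *.
destruct (bipullback_ob Hi) as [c [k [x [Hk [Hx E]]]]].
exists c, k, (chi • x); split; [|split].
- exact Hk.
- rewrite postcomp_comp, vcompA, E, <- vcompA, Ei; reflexivity.
- intros c' k' x' E'.
  destruct Hk as [ki [Hk Hk']], Hx as [xi [Hx Hx']]; simpl in *.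
  destruct (sq_whisker_inv c') as [w [Hw Hw']]; simpl in *.
  (* The leg [x'] factors through the cartesian [chi], over the 2-cell that [E'] prescribes. *)
  destruct (@cartesian_lift _ _ p K v0 v chi _ x' (i • (n ◁ k') • w) Hp)
    as [y [[Hy Hy'] Uy]].
  { rewrite <- vcompA, Ei, <- vcompA, <- E', vcompA, Hw'; symmetry; apply vcomp1r. }
  (* Undoing the invertible [k] and [x] makes [k'] and [y] a morphism of the pseudo-comma category,
     which full faithfulness lifts. *)
  destruct (@bipullback_hom K c' c (ki • k') (xi • y)) as [a [[Ha Ha'] Ua]].
  { rewrite !postcomp_comp, Hy', !vcompA, Hw, vcomp1r.
    assert (Ex : (p ◁ xi) • i = sq_whisker c • (n ◁ ki)).
    { rewrite <- (vcomp1r i), <- hcomp_id, <- Hk', postcomp_comp, <- (vcompA i).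
      rewrite <- E, vcompA, <- vcompA, <- postcomp_comp, Hx, hcomp_id.
      apply vcomp1l. }
    rewrite <- vcompA, Ex, vcompA; reflexivity. }
  exists a; split.
  + rewrite Ha, Ha', vcompA, <- !(vcompA _ xi), <- (vcompA k), Hk', Hx', !vcomp1l; auto.
  + intros a' [<- <-]; apply Ua; split.
    * rewrite <- vcompA, Hk, vcomp1l; reflexivity.
    (* Uniqueness of the lift through [chi] identifies [y] with [x • (sq_c s ◁ a')]. *)
    * rewrite (Uy (x • (sq_c s ◁ a'))).
      -- rewrite <- vcompA, Hx, vcomp1l; reflexivity.
      -- split; [symmetry; apply vcompA|].
         rewrite !postcomp_comp, <- (vcomp1r ((p ◁ x) • _)), <- Hw', !vcompA.
         rewrite <- (vcompA (p ◁ (sq_c s ◁ a'))), sq_whisker_nat.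
         rewrite !vcompA, <- (vcompA (p ◁ x)), E, !vcompA; reflexivity.
Qed.

End Bipullbacks.

(** * Right lifters *)

Section RightLifters.
Context (M : bicategory).

Lemma right_lifter_id (X : M) : right_lifter (id1 X).
Proof.
intros K u; exists u, (lunit u); intros v g; exists (g • luniti v); split.
- rewrite lunit_nat, vcompA, lunitK; apply vcomp1r.
- intros b <-; rewrite lunit_nat, vcompA, lunitiK; apply vcomp1r.
Qed.

(** Liftings are iterated: lift [u] through [m], then the result through [n]. *)
Lemma right_lifter_comp (X Y Z : M) (m : mor Y Z) (n : mor X Y) :
  right_lifter m -> right_lifter n -> right_lifter (m ∘ n).
Proof.
intros Hm Hn K u.
destruct (Hm K u) as [r [w Hw]], (Hn K r) as [r' [w' Hw']].
exists r', (w • (m ◁ w') • assoc m n r'); intros v g.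
destruct (Hw _ (g • associ m n v)) as [b [Eb Ub]].
destruct (Hw' _ b) as [b' [Eb' Ub']].
exists b'; split.
- rewrite !vcompA, assoc_natL, <- (vcompA (m ◁ w')), <- postcomp_comp, Eb'.
  rewrite <- vcompA, Eb, vcompA, assocK; apply vcomp1r.
- intros a <-; apply Ub'; symmetry; apply Ub.
  rewrite !vcompA, postcomp_comp; do 2 f_equal.
  rewrite <- vcompA, assoc_natL, vcompA, associK; symmetry; apply vcomp1r.
Qed.

(** The lifting of [u] is the lax universal cone over the lifting 2-cell [w] of [p ∘ u] through [n].
    A 2-cell [g] out of [sq_c s ∘ v] determines the other leg of a cone uniquely, because [w] is a
    right lifting. *)
Lemma right_lifter_bipullback (A B C : M) (n : mor A C) (p : mor B C)
    (s : square n p) :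
  is_bipullback s -> groupoid_fibration p -> right_lifter n ->
  right_lifter (sq_c s).
Proof.
intros Hs Hp Hn K u.
destruct (Hn K (p ∘ u)) as [r [w Hw]].
destruct (lax_universal Hs Hp w) as [c [k [x [_ [E U]]]]].
exists c, x; intros v g.
destruct (Hw _ ((p ◁ g) • sq_whisker v)) as [b [Eb Ub]].
destruct (U v b g (eq_sym Eb)) as [a [[Ea Ea'] Ua]].
exists a; split; [exact Ea'|].
intros a' E'; apply Ua; split; [|exact E'].
symmetry; apply Ub.
rewrite <- E', !postcomp_comp, !vcompA, sq_whisker_nat, <- !(vcompA w), <- E.
rewrite !vcompA; reflexivity.
Qed.

End RightLifters.

(** * The action of spans on copresheaves *)

Section Copresheaves.
Context (M : bicategory).

(** Values are types with an equivalence relation, so that colimits need no quotient types. *)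
Record copresheaf (K X : M) : Type := Copresheaf {
  cp_ob :> mor K X -> Type;
  cp_eq : forall b, cp_ob b -> cp_ob b -> Prop;
  cp_act : forall b b', b ==> b' -> cp_ob b -> cp_ob b';
  cp_equiv : forall b, RelationClasses.Equivalence (@cp_eq b);
  cp_act_eq : forall b b' (g : b ==> b') x y,
    cp_eq x y -> cp_eq (cp_act g x) (cp_act g y);
  cp_act_id : forall b (x : cp_ob b), cp_eq (cp_act (id2 b) x) x;
  cp_act_comp : forall b b' b'' (h : b' ==> b'') (g : b ==> b') x,
    cp_eq (cp_act (h • g) x) (cp_act h (cp_act g x))
}.
#[global] Existing Instance cp_equiv.
Arguments cp_eq {K X c b}.
Arguments cp_act {K X c b b'}.
Local Notation "x ≡ y" := (cp_eq x y) (at level 70).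

Record cp_map (K X : M) (T U : copresheaf K X) : Type := CpMap {
  cm :> forall b, T b -> U b;
  cm_eq : forall b (x y : T b), x ≡ y -> cm x ≡ cm y;
  cm_nat : forall b b' (g : b ==> b') (x : T b),
    cm (cp_act g x) ≡ cp_act g (cm x)
}.

Definition yoneda (K X : M) (c : mor K X) : copresheaf K X.
Proof.
refine (@Copresheaf K X (fun b => c ==> b) (fun b => eq)
  (fun b b' g x => g • x) _ _ _ _).
- intros b b' g x y <-; reflexivity.
- intros; apply vcomp1l.
- intros; apply vcompA.
Defined.

Section SpanCopresheaf.
Context (K X Y : M) (f : span X Y) (T : copresheaf K Y).

Record span_elt (b : mor K X) : Type := SpanElt {
  se_s : mor K (apex f);
  se_l : lleg f ∘ se_s ==> b;
  se_t : T (rleg f ∘ se_s)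
}.

(** The coend relation, generated by 2-cells between first components. Reflexivity is the step along
    an identity 2-cell. *)
Inductive span_eq (b : mor K X) : span_elt b -> span_elt b -> Prop :=
| span_step (x y : span_elt b) (a : se_s x ==> se_s y) :
    se_l x = se_l y • (lleg f ◁ a) -> cp_act (rleg f ◁ a) (se_t x) ≡ se_t y ->
    span_eq x y
| span_sym (x y : span_elt b) : span_eq x y -> span_eq y x
| span_trans (x y z : span_elt b) : span_eq x y -> span_eq y z -> span_eq x z.

Lemma span_eq_val (b : mor K X) (s : mor K (apex f)) (l l' : lleg f ∘ s ==> b)
    (t t' : T (rleg f ∘ s)) :
  l = l' -> t ≡ t' -> span_eq (SpanElt l t) (SpanElt l' t').
Proof.
intros <- E; apply (@span_step _ (SpanElt l t) (SpanElt l t') (id2 s)); simpl;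
  rewrite hcomp_id.
- symmetry; apply vcomp1r.
- transitivity t; [apply cp_act_id | exact E].
Qed.

Definition span_act (b b' : mor K X) (g : b ==> b') (x : span_elt b) :
    span_elt b' :=
  SpanElt (g • se_l x) (se_t x).

(** The left Kan extension along [lleg f] of the restriction of [T] along
    [rleg f], computed as a coend. *)
Definition span_copresheaf : copresheaf K X.
Proof.
refine (@Copresheaf K X span_elt span_eq span_act _ _ _ _).
- intros b; split.
  + intros [s l t]; apply span_eq_val; reflexivity.
  + intros x y; apply span_sym.
  + intros x y z; apply span_trans.
- intros b b' g x y H; induction H as [x y a El Et | x y _ IH | x y z _ IH _ IH'].
  + apply (@span_step _ (span_act g x) (span_act g y) a); simpl;
      [rewrite El; symmetry; apply vcompA | exact Et].
  + apply span_sym, IH.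
  + exact (span_trans IH IH').
- intros b [s l t]; apply span_eq_val; [apply vcomp1l | reflexivity].
- intros b b' b'' h g [s l t]; apply span_eq_val; [apply vcompA | reflexivity].
Defined.

Lemma span_copresheaf_step (b : mor K X) (x y : span_copresheaf b)
    (a : se_s x ==> se_s y) :
  se_l x = se_l y • (lleg f ◁ a) -> cp_act (rleg f ◁ a) (se_t x) ≡ se_t y -> x ≡ y.
Proof. exact (@span_step b x y a). Qed.

Lemma span_copresheaf_val (b : mor K X) (s : mor K (apex f)) (l l' : lleg f ∘ s ==> b)
    (t t' : T (rleg f ∘ s)) :
  l = l' -> t ≡ t' ->
  cp_eq (c := span_copresheaf) (SpanElt l t) (SpanElt l' t').
Proof. apply span_eq_val. Qed.

(** A device for injectivity proofs: [Q] relates representatives to their candidate preimages, and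
    only generating steps must be checked. Totality of [Q] supplies the middle preimage for
    transitivity. *)
Lemma span_eq_transfer (b : mor K X) (P : Type) (eqP : P -> P -> Prop)
    (Q : P -> span_elt b -> Prop) :
  (forall e e', eqP e e' -> eqP e' e) ->
  (forall e e' e'', eqP e e' -> eqP e' e'' -> eqP e e'') ->
  (forall x, exists e, Q e x) ->
  (forall (x y : span_elt b) (a : se_s x ==> se_s y),
     se_l x = se_l y • (lleg f ◁ a) -> cp_act (rleg f ◁ a) (se_t x) ≡ se_t y ->
     forall e e', Q e x -> Q e' y -> eqP e e') ->
  forall x y, span_eq x y -> forall e e', Q e x -> Q e' y -> eqP e e'.
Proof.
intros sym trans ex tied x y H.
induction H as [x y a El Et | x y _ IH | x y z _ IH _ IH']; intros e e' He He'.
- exact (tied _ _ _ El Et _ _ He He').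
- apply sym, IH; assumption.
- destruct (ex y) as [e0 He0]; apply (trans _ e0); auto.
Qed.

End SpanCopresheaf.
End Copresheaves.
#[global] Existing Instance cp_equiv.
Arguments cp_eq {M K X c b} x y : simpl never.
Arguments cp_act {M K X c b b'}.
Arguments SpanElt {M K X Y f T b} se_s se_l se_t.
Notation "x ≡ y" := (cp_eq x y) (at level 70) : bicat_scope.

Lemma cp_act_congr (M : bicategory) (K X : M) (T : copresheaf K X) (b b' : mor K X)
    (g g' : b ==> b') (x : T b) :
  g = g' -> cp_act g x ≡ cp_act g' x.
Proof. intros <-; reflexivity. Qed.

Ltac step a :=
  lazymatch goal with
  | |- @cp_eq _ _ _ (span_copresheaf ?f ?T) ?b ?x ?y =>
      refine (@span_copresheaf_step _ _ _ _ f T b x y a _ _); simpl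
  end.

(** * Natural maps induced by polynomial morphisms *)

Section Maps.
Context (M : bicategory) (K : M).

Definition span_map (X Y : M) (f : span X Y) (T U : copresheaf K Y)
    (t : cp_map T U) : cp_map (span_copresheaf f T) (span_copresheaf f U).
Proof.
refine (@CpMap M K X (span_copresheaf f T) (span_copresheaf f U)
  (fun b x => SpanElt (se_s x) (se_l x) (t _ (se_t x))) _ _).
- intros b x y H; induction H as [x y a El Et | x y _ IH | x y z _ IH _ IH'].
  + step (a); [exact El|]; simpl.
    etransitivity; [symmetry; apply cm_nat | apply cm_eq, Et].
  + symmetry; exact IH.
  + etransitivity; [exact IH | exact IH'].
- intros b b' g [s l u]; reflexivity.
Defined.

Definition lambda_at (X Y : M) (f f' : span X Y) (x : pmor f f')
    (s : mor K (apex f)) : lleg f' ∘ (pm_h x ∘ s) ==> lleg f ∘ s :=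
  (pm_lambda x ▷ s) • associ (lleg f') (pm_h x) s.

Definition rho_at (X Y : M) (f f' : span X Y) (x : pmor f f')
    (s : mor K (apex f)) : rleg f ∘ s ==> rleg f' ∘ (pm_h x ∘ s) :=
  assoc (rleg f') (pm_h x) s • (pm_rho x ▷ s).

Lemma lambda_at_nat (X Y : M) (f f' : span X Y) (x : pmor f f')
    (s s' : mor K (apex f)) (a : s ==> s') :
  lambda_at x s' • (lleg f' ◁ (pm_h x ◁ a)) = (lleg f ◁ a) • lambda_at x s.
Proof.
unfold lambda_at.
rewrite vcompA, associ_natL, <- vcompA, whisker_exchange; apply vcompA.
Qed.

Lemma rho_at_nat (X Y : M) (f f' : span X Y) (x : pmor f f')
    (s s' : mor K (apex f)) (a : s ==> s') :
  rho_at x s' • (rleg f ◁ a) = (rleg f' ◁ (pm_h x ◁ a)) • rho_at x s.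
Proof.
unfold rho_at.
rewrite vcompA, whisker_exchange, <- vcompA, assoc_natL; apply vcompA.
Qed.

Definition pmor_map (X Y : M) (f f' : span X Y) (x : pmor f f')
    (T : copresheaf K Y) : cp_map (span_copresheaf f T) (span_copresheaf f' T).
Proof.
refine (@CpMap M K X (span_copresheaf f T) (span_copresheaf f' T)
  (fun b e => SpanElt (pm_h x ∘ se_s e) (se_l e • lambda_at x (se_s e))
                (cp_act (rho_at x (se_s e)) (se_t e))) _ _).
- intros b e e' H; induction H as [e e' a El Et | e e' _ IH | e e' e'' _ IH _ IH'].
  + step (pm_h x ◁ a).
    * rewrite El, !vcompA, lambda_at_nat; reflexivity.
    * etransitivity; [symmetry; apply cp_act_comp|].
      rewrite <- rho_at_nat.
      etransitivity; [apply cp_act_comp | apply cp_act_eq, Et].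
  + symmetry; exact IH.
  + etransitivity; [exact IH | exact IH'].
- intros b b' g [s l t]; apply span_copresheaf_val; [apply vcompA | reflexivity].
Defined.

Lemma pmor_map_nat (X Y : M) (f f' : span X Y) (x : pmor f f')
    (T U : copresheaf K Y) (t : cp_map T U) b (e : span_copresheaf f T b) :
  pmor_map x U _ (span_map f t _ e) ≡ span_map f' t _ (pmor_map x T _ e).
Proof. apply span_copresheaf_val; [reflexivity | symmetry; apply cm_nat]. Qed.

Lemma span_map_ext (X Y : M) (f : span X Y) (T U : copresheaf K Y)
    (t t' : cp_map T U) b (e : span_copresheaf f T b) :
  (forall b' (x : T b'), t _ x ≡ t' _ x) -> span_map f t _ e ≡ span_map f t' _ e.
Proof. intros E; apply span_copresheaf_val; [reflexivity | apply E]. Qed.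

Lemma pmor_map_id (X Y : M) (f : span X Y) (T : copresheaf K Y) b
    (e : span_copresheaf f T b) :
  pmor_map (pmor_id f) T _ e ≡ e.
Proof.
destruct e as [s l t]; step (lunit s).
- f_equal; unfold lambda_at; simpl; rewrite whiskerR_runit, vcompA, associK.
  apply vcomp1r.
- unfold rho_at; simpl; etransitivity; [symmetry; apply cp_act_comp|].
  rewrite <- vcompA, <- whiskerR_runit, whiskerR_cancel by apply runitiK.
  apply cp_act_id.
Qed.

Lemma pmor_map_comp (X Y : M) (f f' f'' : span X Y) (y : pmor f' f'')
    (x : pmor f f') (T : copresheaf K Y) b (e : span_copresheaf f T b) :
  pmor_map (pmor_comp y x) T _ e ≡ pmor_map y T _ (pmor_map x T _ e).
Proof.
destruct e as [s l t]; step (assoc (pm_h y) (pm_h x) s).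
- rewrite vcompA; f_equal; unfold lambda_at; simpl.
  rewrite !whiskerR_vcomp, whiskerR_associ, whiskerR_whiskerR, !vcompA.
  rewrite associK, vcomp1r, associK_l; reflexivity.
- etransitivity; [symmetry; apply cp_act_comp|].
  etransitivity; [|apply cp_act_comp].
  match goal with |- cp_act ?u _ ≡ cp_act ?v _ => replace u with v; [reflexivity|] end.
  unfold rho_at; simpl.
  rewrite !whiskerR_vcomp, whiskerR_assoc, whiskerR_whiskerR, !vcompA.
  rewrite !associK_l, whiskerL_cancel_l by apply associK.
  reflexivity.
Qed.

Lemma pmor_map_iso (X Y : M) (f f' : span X Y) (x y : pmor f f')
    (T : copresheaf K Y) b (e : span_copresheaf f T b) :
  pmor_isomorphic x y -> pmor_map x T _ e ≡ pmor_map y T _ e.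
Proof.
intros [s [_ [El Er]]]; step (s ▷ se_s e).
- rewrite vcompA; f_equal; unfold lambda_at.
  rewrite El, whiskerR_vcomp, whiskerR_whiskerL, !vcompA, associK, vcomp1r.
  reflexivity.
- etransitivity; [symmetry; apply cp_act_comp|].
  unfold rho_at.
  rewrite Er, whiskerR_vcomp, whiskerR_whiskerL, !vcompA, associK_l; reflexivity.
Qed.

End Maps.

(** * Polynomial morphisms as elements, and faithfulness of the action *)

Section Faithful.
Context (M : bicategory) (X Y : M).

(** The Yoneda element of [x]: by [pmor_map_elt_id] it is the image under [pmor_map x] of the
    element of the identity. *)
Definition pmor_elt (w f : span X Y) (x : pmor w f) :
    span_copresheaf f (yoneda (rleg w)) (lleg w) :=
  SpanElt (f := f) (T := yoneda (rleg w)) (pm_h x) (pm_lambda x) (pm_rho x).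

Lemma pmor_map_elt (w f f' : span X Y) (y : pmor f f') (x : pmor w f) :
  pmor_map y _ _ (pmor_elt x) ≡ pmor_elt (pmor_comp y x).
Proof. apply span_copresheaf_val; [reflexivity | apply vcompA]. Qed.

Lemma pmor_map_elt_id (w f : span X Y) (x : pmor w f) :
  pmor_map x _ _ (pmor_elt (pmor_id w)) ≡ pmor_elt x.
Proof.
step (runit (pm_h x)).
- unfold lambda_at; rewrite <- vcompA, runit_nat, vcompA, <- runit_comp, vcompA.
  rewrite associK, vcomp1r; reflexivity.
- unfold rho_at; rewrite <- !vcompA, runit_comp, runit_nat, vcompA, runitiK.
  apply vcomp1r.
Qed.

(** Let [Q] consist of the elements reached from [x] by a 2-cell compatible with the structure.
    Generating steps preserve [Q] in both directions, so [Q] contains the element of [y]. *)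
Lemma pmor_elt_inj (w f : span X Y) (x y : pmor w f) :
  groupoid_fibration (rleg f) -> pmor_elt x ≡ pmor_elt y -> pmor_isomorphic x y.
Proof.
intros Hf.
destruct (pm_rho_inv x) as [r [Hr Hr']]; simpl in *.
set (Q := fun (e : span_copresheaf f (yoneda (rleg w)) (lleg w)) =>
  exists s : pm_h x ==> se_s e,
    pm_lambda x = se_l e • (lleg f ◁ s) /\ se_t e = (rleg f ◁ s) • pm_rho x).
assert (HQ : forall e e', span_eq e e' -> (Q e <-> Q e')).
{ intros e e' H; induction H as [e e' a El Er | | ]; [|tauto..].
  change ((rleg f ◁ a) • se_t e = se_t e') in Er; split; intros [s [Hl Ht]].
  - exists (a • s); split.
    + rewrite postcomp_comp, <- vcompA, <- El; exact Hl.
    + rewrite postcomp_comp, vcompA, <- Ht; auto.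
  (* To go backwards along the step [a], factor [s] through [a], which is cartesian. *)
  - destruct (@cartesian_lift _ _ _ (rleg f) _ _ _ a _ s (se_t e • r) Hf)
      as [c [[Hc Hc'] _]].
    { rewrite <- vcompA, Er, Ht, vcompA, Hr', vcomp1r; reflexivity. }
    exists c; split.
    + rewrite El, vcompA, <- postcomp_comp, Hc; exact Hl.
    + rewrite Hc', vcompA, Hr, vcomp1r; reflexivity. }
intros H; destruct (proj1 (HQ _ _ H)) as [s [Hl Ht]].
{ exists (id2 _); rewrite !hcomp_id; simpl; rewrite vcomp1r, vcomp1l; auto. }
exists s; split; [|split; assumption].
(* The image of [s] is [pm_rho y • r], which is invertible, and [rleg f] reflects invertibility. *)
apply (invertible_conservative Hf); simpl in *.
assert (E : rleg f ◁ s = pm_rho y • r).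
{ rewrite Ht, vcompA, Hr', vcomp1r; reflexivity. }
rewrite E; apply invertible_vcomp; [apply pm_rho_inv | exists (pm_rho x); auto].
Qed.

(** The lift [chi] that makes [t] invertible is itself a generating step from the new representative
    to the old one. *)
Lemma pmor_elt_surj (w f : span X Y)
    (e : span_copresheaf f (yoneda (rleg w)) (lleg w)) :
  groupoid_fibration (rleg f) -> exists x : pmor w f, pmor_elt x ≡ e.
Proof.
intros Hf; destruct e as [s l t]; simpl in t.
destruct (Hf (apex w)) as [lift _].
destruct (lift s (rleg w) t) as [s0 [chi [i [Hi E]]]]; simpl in s0, chi, i, E.
exists (@Pmor M X Y w f s0 (l • (lleg f ◁ chi)) i Hi).
step chi; [reflexivity | exact E].
Qed.

(** The Yoneda argument: evaluate both maps at the element of the identity. *)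
Lemma pmor_isomorphic_of_map (f f' : span X Y) (x y : pmor f f') :
  groupoid_fibration (rleg f') ->
  (forall (K : M) (T : copresheaf K Y) b (e : span_copresheaf f T b),
     pmor_map x T b e ≡ pmor_map y T b e) ->
  pmor_isomorphic x y.
Proof.
intros Hf E; apply (pmor_elt_inj Hf).
etransitivity; [symmetry; apply pmor_map_elt_id|].
etransitivity; [apply E | apply pmor_map_elt_id].
Qed.

Lemma pmor_inverse (f f' : span X Y) (x : pmor f f') :
  groupoid_fibration (rleg f) -> groupoid_fibration (rleg f') ->
  (forall (K : M) (T : copresheaf K Y) b (e e' : span_copresheaf f T b),
     pmor_map x T b e ≡ pmor_map x T b e' -> e ≡ e') ->
  (forall (K : M) (T : copresheaf K Y) b (e' : span_copresheaf f' T b),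
     exists e, pmor_map x T b e ≡ e') ->
  exists z : pmor f' f,
    pmor_isomorphic (pmor_comp x z) (pmor_id f') /\
    pmor_isomorphic (pmor_comp z x) (pmor_id f).
Proof.
intros Hf Hf' inj surj.
(* A preimage of the element of the identity of [f'] is the element of a morphism [z], which is a
   right inverse of [x]. *)
destruct (surj _ _ _ (pmor_elt (pmor_id f'))) as [e He].
destruct (pmor_elt_surj e Hf) as [z Hz].
assert (E : pmor_isomorphic (pmor_comp x z) (pmor_id f')).
{ apply (pmor_elt_inj Hf').
  etransitivity; [symmetry; apply pmor_map_elt|].
  etransitivity; [apply cm_eq, Hz | exact He]. }
exists z; split; [exact E|].
(* Injectivity cancels [x] on the left from [x z x = x]. *)
apply (pmor_elt_inj Hf), inj.
etransitivity; [apply cm_eq; symmetry; apply pmor_map_elt|].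
etransitivity; [symmetry; apply pmor_map_comp|].
etransitivity; [apply pmor_map_iso, E|].
etransitivity; [apply pmor_map_id|].
symmetry; apply pmor_map_elt_id.
Qed.

End Faithful.

(** * Preservation of bijections by the action of a span *)

Section Bijections.
Context (M : bicategory) (K X Y : M).

Definition cp_injective (T U : copresheaf K X) (t : cp_map T U) : Prop :=
  forall b (x y : T b), t b x ≡ t b y -> x ≡ y.

Definition cp_surjective (T U : copresheaf K X) (t : cp_map T U) : Prop :=
  forall b (y : U b), exists x, t b x ≡ y.

Lemma span_map_surjective (f : span X Y) (T U : copresheaf K Y) (t : cp_map T U) 
    b (e : span_copresheaf f U b) :
  (forall b' (y : U b'), exists x, t b' x ≡ y) -> exists e', span_map f t b e' ≡ e.
Proof.
intros Ht; destruct e as [s l u], (Ht _ u) as [v Hv].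
exists (SpanElt s l v); apply span_copresheaf_val; auto.
Qed.

(** Surjectivity of [t] lifts every intermediate element of a zigzag in the target; injectivity of
    [t] makes the lifted steps valid. *)
Lemma span_map_injective (f : span X Y) (T U : copresheaf K Y) (t : cp_map T U)
    b (e e' : span_copresheaf f T b) :
  (forall b' (x y : T b'), t b' x ≡ t b' y -> x ≡ y) ->
  (forall b' (y : U b'), exists x, t b' x ≡ y) ->
  span_map f t b e ≡ span_map f t b e' -> e ≡ e'.
Proof.
intros inj surj H.
refine (@span_eq_transfer _ _ _ _ f U b (span_copresheaf f T b) (fun x y => x ≡ y)
  (fun e x => exists t0 : T (rleg f ∘ se_s x),
     t _ t0 ≡ se_t x /\ e ≡ SpanElt (se_s x) (se_l x) t0)
  _ _ _ _ _ _ H e e' _ _).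
- intros; symmetry; assumption.
- intros x y z ? ?; transitivity y; assumption.
- intros [s l u]; destruct (surj _ u) as [v Hv]; exists (SpanElt s l v), v.
  split; [exact Hv | reflexivity].
- intros x y a El Et d d' [v [Hv Ha]] [v' [Hv' Ha']].
  etransitivity; [exact Ha|]; etransitivity; [|symmetry; exact Ha'].
  step a; [exact El|]; apply inj.
  etransitivity; [apply cm_nat|].
  etransitivity; [apply cp_act_eq, Hv|].
  etransitivity; [exact Et | symmetry; exact Hv'].
- exists (se_t e); split; [reflexivity | destruct e; reflexivity].
- exists (se_t e'); split; [reflexivity | destruct e'; reflexivity].
Qed.

End Bijections.

(** * Composites of spans *)

Section Expand.
Context (M : bicategory) (K X Y Z : M) (f : span X Y) (g : span Y Z).
Context (s : square (lleg g) (rleg f)).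

(** A 1-cell into the apex of [s] is sent to its two projections, with the 2-cell of [s] as
    structure 2-cell of the inner element. *)
Definition expand (T : copresheaf K Z) :
  cp_map (span_copresheaf (square_span (lleg f) (rleg g) s) T)
         (span_copresheaf f (span_copresheaf g T)).
Proof.
refine (@CpMap M K X (span_copresheaf (square_span (lleg f) (rleg g) s) T)
  (span_copresheaf f (span_copresheaf g T))
  (fun b e => SpanElt (f := f) (T := span_copresheaf g T)
     (sq_c s ∘ se_s e) (se_l e • associ (lleg f) (sq_c s) (se_s e))
     (SpanElt (sq_d s ∘ se_s e) (sq_whisker (se_s e))
        (cp_act (assoc (rleg g) (sq_d s) (se_s e)) (se_t e)))) _ _).
- intros b e e' H; induction H as [e e' a El Et | e e' _ IH | e e' e'' _ IH _ IH'].
  + simpl in a, El, Et; step (sq_c s ◁ a).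
    * rewrite El, !vcompA, associ_natL; reflexivity.
    * step (sq_d s ◁ a).
      -- apply sq_whisker_nat.
      -- etransitivity; [symmetry; apply cp_act_comp|].
         rewrite <- assoc_natL.
         etransitivity; [apply cp_act_comp | apply cp_act_eq, Et].
  + symmetry; exact IH.
  + etransitivity; [exact IH | exact IH'].
- intros b b' h [u l t]; apply span_copresheaf_val; [apply vcompA | reflexivity].
Defined.

Lemma expand_nat (T U : copresheaf K Z) (t : cp_map T U) b
    (e : span_copresheaf (square_span (lleg f) (rleg g) s) T b) :
  expand U _ (span_map _ t _ e) ≡ span_map f (span_map g t) _ (expand T _ e).
Proof.
apply span_copresheaf_val; [reflexivity|].
apply span_copresheaf_val; [reflexivity|].
symmetry; apply cm_nat.
Qed.

(** * Bijectivity of the expansion over a bipullback *)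

Section Bijective.
Context (Hs : is_bipullback s) (Hf : groupoid_fibration (rleg f)).
Context (T : copresheaf K Z).
Notation composite := (span_copresheaf (square_span (lleg f) (rleg g) s) T).

(** The pair [k], [x] is a cone in the sense of [lax_universal] over the 2-cell carried by [E],
    compatible with the remaining data. *)
Definition over (b : mor K X) (e : composite b)
    (E : span_copresheaf f (span_copresheaf g T) b) : Prop :=
  exists (k : sq_d s ∘ se_s e ==> se_s (se_t E)) (x : sq_c s ∘ se_s e ==> se_s E),
    (rleg f ◁ x) • sq_whisker (se_s e) = se_l (se_t E) • (lleg g ◁ k) /\
    se_l e = se_l E • (lleg f ◁ x) • assoc (lleg f) (sq_c s) (se_s e) /\
    cp_act ((rleg g ◁ k) • assoc (rleg g) (sq_d s) (se_s e)) (se_t e)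
      ≡ se_t (se_t E).

Lemma over_expand b (e : composite b) : over e (expand T b e).
Proof.
exists (id2 _), (id2 _); simpl; rewrite !hcomp_id, !vcomp1l, vcomp1r, !vcompA.
rewrite assocK, vcomp1r; repeat split; reflexivity.
Qed.

Lemma expand_over b (e : composite b) E : over e E -> expand T b e ≡ E.
Proof.
intros [k [x [Ew [El Et]]]]; step x.
- rewrite El, !vcompA, associK, vcomp1r; reflexivity.
- step k; [exact Ew|].
  etransitivity; [symmetry; apply cp_act_comp | exact Et].
Qed.

(** The element [e0] comes from the lax universal cone; any other cone factors through it, and the
    factorization is a generating step. *)
Lemma over_terminal b (E : span_copresheaf f (span_copresheaf g T) b) :
  exists e0 : composite b, over e0 E /\ forall e, over e E -> e ≡ e0.
Proof.
destruct E as [v l [u th t]].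
destruct (lax_universal Hs Hf th) as [c [k [x [[k' [Hk Hk']] [E U]]]]].
simpl in k', Hk, Hk'.
(* The inner datum [t] is transported back along [k], which is invertible. *)
exists (SpanElt (f := square_span (lleg f) (rleg g) s) c
  (l • (lleg f ◁ x) • assoc (lleg f) (sq_c s) c)
  (cp_act (associ (rleg g) (sq_d s) c • (rleg g ◁ k')) t)); split.
- exists k, x; split; [exact E | split; [reflexivity|]].
  etransitivity; [symmetry; apply cp_act_comp|]; simpl.
  rewrite !vcompA, associK_l, whiskerL_cancel by exact Hk'; apply cp_act_id.
- intros e0 [k0 [x0 [Ew [El Et]]]]; simpl in *.
  destruct (U _ _ _ Ew) as [a [[Ea Ea'] _]].
  step a.
  + rewrite El, !vcompA, assoc_natL, <- Ea', postcomp_comp, !vcompA; reflexivity.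
  + etransitivity; [|apply cp_act_eq, Et].
    etransitivity; [|apply cp_act_comp].
    rewrite <- Ea, postcomp_comp, !vcompA, whiskerL_cancel_l by exact Hk.
    rewrite <- assoc_natL, assocK_l; reflexivity.
Qed.

Lemma over_unique b E (e e' : composite b) : over e E -> over e' E -> e ≡ e'.
Proof.
destruct (over_terminal E) as [e0 [_ H]]; intros He He'.
transitivity e0; [apply H, He | symmetry; apply H, He'].
Qed.

Lemma expand_surjective : cp_surjective (expand T).
Proof.
intros b E; destruct (over_terminal E) as [e [He _]].
exists e; apply expand_over, He.
Qed.

(** The 2-cell [a] of an outer step is absorbed into the second leg of the cone. *)
Lemma over_step b (x y : span_copresheaf f (span_copresheaf g T) b)
    (a : se_s x ==> se_s y) :
  se_l x = se_l y • (lleg f ◁ a) ->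
  forall e : composite b, over e x ->
  over e (SpanElt (f := f) (T := span_copresheaf g T) (se_s y) (se_l y)
            (cp_act (rleg f ◁ a) (se_t x))).
Proof.
intros Ea e [k [x0 [Ew [El Et]]]]; exists k, (a • x0); simpl; split; [|split].
- rewrite postcomp_comp, !vcompA, Ew; reflexivity.
- rewrite El, Ea, postcomp_comp, !vcompA; reflexivity.
- exact Et.
Qed.

(** With the outer data fixed, the 2-cell of an inner step is absorbed into the first leg [k] of the
    cone, and [over_unique] applies. *)
Lemma over_inner b v (l : lleg f ∘ v ==> b) (x y : span_copresheaf g T (rleg f ∘ v)) :
  x ≡ y ->
  forall e e' : composite b,
  over e (SpanElt (f := f) (T := span_copresheaf g T) v l x) ->
  over e' (SpanElt (f := f) (T := span_copresheaf g T) v l y) ->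
  e ≡ e'.
Proof.
apply (@span_eq_transfer _ _ _ _ g T (rleg f ∘ v) (composite b)
  (fun e e' => e ≡ e') (fun e x => over e (SpanElt (f := f)
     (T := span_copresheaf g T) v l x))); clear x y.
- intros; symmetry; assumption.
- intros ? u ? ? ?; transitivity u; assumption.
- intros x.
  destruct (over_terminal (SpanElt (f := f) (T := span_copresheaf g T) v l x))
    as [e [He _]]; exists e; exact He.
- intros x y a Ea Et e e' [k [x0 [Ew [El Et0]]]] He'; simpl in *.
  refine (over_unique _ He'); exists (a • k), x0; simpl; split; [|split].
  + rewrite Ew, Ea, postcomp_comp, !vcompA; reflexivity.
  + exact El.
  + etransitivity; [|exact Et].
    rewrite postcomp_comp, vcompA.
    etransitivity; [apply cp_act_comp | apply cp_act_eq, Et0].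
Qed.

(** The relation [over] serves as [Q] in [span_eq_transfer]. A generating step splits into a move of
    the outer coordinate and an equivalence of inner elements. *)
Lemma expand_injective : cp_injective (expand T).
Proof.
intros b e e' H.
refine (@span_eq_transfer _ _ _ _ f _ b (composite b) (fun x y => x ≡ y)
  (@over b) _ _ _ _ _ _ H e e' (over_expand e) (over_expand e')).
- intros; symmetry; assumption.
- intros ? u ? ? ?; transitivity u; assumption.
- intros E; destruct (over_terminal E) as [e0 [He _]]; exists e0; exact He.
- intros x y a Ea Et d d' Hd Hd'; destruct y as [v l y].
  exact (over_inner Et (over_step (y := SpanElt v l y) Ea Hd) Hd').
Qed.

End Bijective.
End Expand.

(** * Fillers act as horizontal composites *)

Section Filler.
Context (M : bicategory) (K X Y Z : M) (f f' : span X Y) (g g' : span Y Z).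
Context (s : square (lleg g) (rleg f)) (s' : square (lleg g') (rleg f')).
Context (y : pmor g g') (x : pmor f f') (d : filler s s' y x).

Lemma filler_at (c : mor K (sq_apex s)) :
  (rleg f' ◁ (assoc (pm_h x) (sq_c s) c • (fl_sigma d ▷ c)
               • associ (sq_c s') (fl_l d) c))
    • sq_whisker (fl_l d ∘ c)
    • (lleg g' ◁ (assoc (sq_d s') (fl_l d) c • (fl_tau d ▷ c)
               • associ (pm_h y) (sq_d s) c))
  = rho_at x (sq_c s ∘ c) • sq_whisker c • lambda_at y (sq_d s ∘ c).
Proof.
(* The equation of the filler is whiskered with [c] and surrounded by the associators that match the
   goal. *)
pose proof (f_equal (fun a =>
  ((rleg f' ◁ assoc (pm_h x) (sq_c s) c) • assoc (rleg f') (pm_h x ∘ sq_c s) c)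
  • (a ▷ c) • associ (lleg g' ∘ pm_h y) (sq_d s) c
  • associ (lleg g') (pm_h y) (sq_d s ∘ c)) (fl_eq d)) as E.
simpl in E; unfold fill_psi in E; unfold rho_at, lambda_at, sq_whisker in *.
refine (eq_trans _ (eq_trans E _)); coh; reflexivity.
Qed.

(** Both sides lead by one generating step to a common element: the left side by an outer step along
    [fl_sigma], the right side by an inner step along [fl_tau]. *)
Lemma expand_filler (T : copresheaf K Z) b
    (e : span_copresheaf (square_span (lleg f) (rleg g) s) T b) :
  expand s' T _ (pmor_map (filler_pmor d) T _ e)
  ≡ pmor_map x _ _ (span_map f (pmor_map y T) _ (expand s T _ e)).
Proof.
destruct e as [c l t]; simpl in c, l, t.
transitivity (SpanElt (f := f') (T := span_copresheaf g' T)
  (pm_h x ∘ (sq_c s ∘ c))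
  ((l • associ (lleg f) (sq_c s) c) • lambda_at x (sq_c s ∘ c))
  (SpanElt (sq_d s' ∘ (fl_l d ∘ c))
    ((rleg f' ◁ (assoc (pm_h x) (sq_c s) c • (fl_sigma d ▷ c)
               • associ (sq_c s') (fl_l d) c)) • sq_whisker (fl_l d ∘ c))
    (cp_act (assoc (rleg g') (sq_d s') (fl_l d ∘ c)
       • rho_at (filler_pmor d) c) t))).
- step (assoc (pm_h x) (sq_c s) c • (fl_sigma d ▷ c) • associ (sq_c s') (fl_l d) c).
  + unfold lambda_at; simpl; coh; reflexivity.
  + apply span_copresheaf_val; [reflexivity | symmetry; apply cp_act_comp].
- apply span_copresheaf_val; [reflexivity|]; symmetry.
  step (assoc (sq_d s') (fl_l d) c • (fl_tau d ▷ c) • associ (pm_h y) (sq_d s) c).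
  + rewrite vcompA, filler_at, <- vcompA; reflexivity.
  + repeat (etransitivity; [symmetry; apply cp_act_comp|]).
    apply cp_act_congr; unfold rho_at; simpl; coh; reflexivity.
Qed.

End Filler.

(** * Invariance of the expansion under maps of squares *)

Section SquareMap.
Context (M : bicategory) (K X Y Z : M) (f : span X Y) (g : span Y Z).
Context (s s' : square (lleg g) (rleg f)) (d : square_map s s').

Lemma square_map_at (c : mor K (sq_apex s)) :
  (rleg f ◁ ((sm_sigma d ▷ c) • associ (sq_c s') (sm_l d) c))
    • sq_whisker (sm_l d ∘ c)
    • (lleg g ◁ (assoc (sq_d s') (sm_l d) c • (sm_tau d ▷ c)))
  = sq_whisker c.
Proof.
pose proof (f_equal (fun a =>
  assoc (rleg f) (sq_c s) c • (a ▷ c) • associ (lleg g) (sq_d s) c) (sm_eq d)) as E.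
simpl in E; unfold sq_whisker in *.
refine (eq_trans _ (eq_trans E _)); coh; reflexivity.
Qed.

Lemma expand_square_map (T : copresheaf K Z) b
    (e : span_copresheaf (square_span (lleg f) (rleg g) s) T b) :
  expand s' T _ (pmor_map (square_map_pmor (lleg f) (rleg g) d) T _ e)
  ≡ expand s T _ e.
Proof.
destruct e as [c l t]; simpl in c, l, t.
transitivity (SpanElt (f := f) (T := span_copresheaf g T)
  (sq_c s ∘ c) (l • associ (lleg f) (sq_c s) c)
  (SpanElt (sq_d s' ∘ (sm_l d ∘ c))
    ((rleg f ◁ ((sm_sigma d ▷ c) • associ (sq_c s') (sm_l d) c))
      • sq_whisker (sm_l d ∘ c))
    (cp_act (assoc (rleg g) (sq_d s') (sm_l d ∘ c)
       • rho_at (square_map_pmor (lleg f) (rleg g) d) c) t))).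
- step ((sm_sigma d ▷ c) • associ (sq_c s') (sm_l d) c).
  + unfold lambda_at; simpl; coh; reflexivity.
  + apply span_copresheaf_val; [reflexivity | symmetry; apply cp_act_comp].
- apply span_copresheaf_val; [reflexivity|]; symmetry.
  step (assoc (sq_d s') (sm_l d) c • (sm_tau d ▷ c)).
  + rewrite vcompA, square_map_at; reflexivity.
  + repeat (etransitivity; [symmetry; apply cp_act_comp|]).
    apply cp_act_congr; unfold rho_at; simpl; coh; reflexivity.
Qed.

End SquareMap.

(** * Rebracketing and stacked squares *)

Section Stacking.
Context (M : bicategory) (K X Y Z W : M).
Context (f : span X Y) (g : span Y Z) (h : span Z W).
Context (P : square (lleg g) (rleg f)) (R : square (lleg h) (rleg g)).
Context (w : square (sq_c R) (sq_d P)).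

Let gf := square_span (lleg f) (rleg g) P.
Let hg := square_span (lleg g) (rleg h) R.
Let hg_f := square_span (lleg f) (rleg hg) (hstack w).
Let h_gf := square_span (lleg gf) (rleg h) (vstack w).
Let bracket : pmor hg_f h_gf :=
  rebracket (lleg f) (sq_c P) (sq_c w) (rleg h) (sq_d R) (sq_d w).

Lemma rebracket_map (T : copresheaf K W) b (e : span_copresheaf hg_f T b) :
  pmor_map bracket T _ e
  ≡ SpanElt (f := h_gf) (se_s e)
      (se_l e • (assoc (lleg f) (sq_c P) (sq_c w) ▷ se_s e))
      (cp_act (assoc (rleg h) (sq_d R) (sq_d w) ▷ se_s e) (se_t e)).
Proof.
destruct e as [c l t]; step (lunit c).
- unfold lambda_at; simpl.
  rewrite whiskerR_vcomp, whiskerR_runit, !vcompA, associK, vcomp1r; reflexivity.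
- etransitivity; [symmetry; apply cp_act_comp|].
  unfold rho_at; simpl; rewrite whiskerR_vcomp, <- !vcompA, <- whiskerR_runit.
  rewrite whiskerR_cancel by apply runitiK; rewrite vcomp1l; reflexivity.
Qed.

Lemma hstack_at (c : mor K (sq_apex w)) :
  (rleg f ◁ assoc (sq_c P) (sq_c w) c) • sq_whisker (s := hstack w) c
    • associ (lleg g) (sq_c R) (sq_d w ∘ c)
  = sq_whisker (sq_c w ∘ c) • (lleg g ◁ sq_whisker c).
Proof.
unfold sq_whisker; simpl; unfold hstack_theta, sq_whisker; coh; reflexivity.
Qed.

Lemma vstack_at (c : mor K (sq_apex w)) :
  assoc (rleg g) (sq_d P) (sq_c w ∘ c) • sq_whisker (s := vstack w) c
    • (lleg h ◁ associ (sq_d R) (sq_d w) c)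
  = (rleg g ◁ sq_whisker c) • sq_whisker (sq_d w ∘ c).
Proof.
unfold sq_whisker; simpl; unfold vstack_theta, sq_whisker; coh; reflexivity.
Qed.

(** Both expansions split an element into components over [f], [g] and [h]. The components over [f]
    and [h] differ by associators, those over [g] by the 2-cell of [w]. *)
Lemma expand_rebracket (T : copresheaf K W) b (e : span_copresheaf hg_f T b) :
  expand P _ _ (expand (f := gf) (vstack w) T _ (pmor_map bracket T _ e))
  ≡ span_map f (expand R T) _ (expand (g := hg) (hstack w) T _ e).
Proof.
etransitivity; [do 2 apply cm_eq; apply rebracket_map|].
destruct e as [c l t]; simpl in c, l, t.
step (associ (sq_c P) (sq_c w) c).
- coh; reflexivity.
- symmetry; step (sq_whisker c).
  + rewrite vcompA, <- hstack_at, whiskerL_cancel_l by apply assocK; reflexivity.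
  + step (associ (sq_d R) (sq_d w) c).
    * rewrite vcompA, vstack_at; reflexivity.
    * repeat (etransitivity; [symmetry; apply cp_act_comp|]).
      etransitivity; [|apply cp_act_comp].
      apply cp_act_congr; coh; reflexivity.
Qed.

End Stacking.

(** * The identity span acts as the identity *)

Section Units.
Context (M : bicategory) (K : M).

(** The density isomorphism, that is, the co-Yoneda lemma. *)
Definition unit_map (X : M) (T : copresheaf K X) :
    cp_map (span_copresheaf (id_span X) T) T.
Proof.
refine (@CpMap M K X (span_copresheaf (id_span X) T) T
  (fun b e => cp_act (se_l e) (se_t e)) _ _).
- intros b e e' H; induction H as [e e' a El Et | e e' _ IH | e e' e'' _ IH _ IH'].
  + rewrite El; etransitivity; [apply cp_act_comp | apply cp_act_eq, Et].
  + symmetry; exact IH.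
  + etransitivity; [exact IH | exact IH'].
- intros; apply cp_act_comp.
Defined.

Lemma unit_map_nat (X : M) (T U : copresheaf K X) (t : cp_map T U) b
    (e : span_copresheaf (id_span X) T b) :
  unit_map U _ (span_map _ t _ e) ≡ t _ (unit_map T _ e).
Proof. symmetry; apply cm_nat. Qed.

Lemma unit_map_surjective (X : M) (T : copresheaf K X) :
  cp_surjective (unit_map T).
Proof.
intros b x.
exists (SpanElt (f := id_span X) b (lunit b) (cp_act (luniti b) x)).
etransitivity; [symmetry; apply cp_act_comp|]; simpl.
rewrite lunitiK; apply cp_act_id.
Qed.

Lemma unit_map_injective (X : M) (T : copresheaf K X) :
  cp_injective (unit_map T).
Proof.
(* Each element is equivalent to a canonical one that depends only on its value under [unit_map]. *)
assert (H : forall b (e : span_copresheaf (id_span X) T b),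
  e ≡ SpanElt (f := id_span X) b (lunit b) (cp_act (luniti b) (unit_map T _ e))).
{ intros b [x l t]; step (l • luniti x); simpl in *.
  - rewrite lunit_nat, vcompA, lunitK; symmetry; apply vcomp1r.
  - etransitivity; [|apply cp_act_comp]; apply cp_act_congr.
    rewrite <- (vcomp1l (_ ◁ _)), <- lunitK, vcompA, lunit_nat, vcompA, lunitK.
    rewrite vcomp1r; reflexivity. }
intros b e e' E; etransitivity; [apply H|]; etransitivity; [|symmetry; apply H].
apply span_copresheaf_val; [reflexivity | apply cp_act_eq, E].
Qed.

End Units.

(** * Unit morphisms of polynomials *)

Section Unitors.
Context (M : bicategory) (X Y : M) (f : span X Y).

(** The 2-cell of the square is already of the form required of [pm_rho]; in [runit_pmor] it serves
    as [pm_lambda]. *)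
Definition lunit_pmor (s : square (id1 Y) (rleg f)) :
    pmor (square_span (lleg f) (id1 Y) s) f :=
  @Pmor M X Y (square_span (lleg f) (id1 Y) s) f (sq_c s) (id2 _) (sq_theta s)
    (sq_theta_inv s).

Definition runit_pmor (s : square (lleg f) (id1 X)) :
    pmor (square_span (id1 X) (rleg f) s) f :=
  @Pmor M X Y (square_span (id1 X) (rleg f) s) f (sq_d s) (sq_theta s) (id2 _)
    (invertible_id _).

Lemma lunit_pmor_map (s : square (id1 Y) (rleg f)) (K : M) (T : copresheaf K Y) b
    (e : span_copresheaf (square_span (lleg f) (id1 Y) s) T b) :
  pmor_map (lunit_pmor s) T _ e
  ≡ span_map f (unit_map T) _ (expand (g := id_span Y) s T _ e).
Proof.
apply span_copresheaf_val; simpl.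
- unfold lambda_at; simpl; rewrite hcomp_id, vcomp1l; reflexivity.
- etransitivity; [|apply cp_act_comp]; apply cp_act_congr.
  unfold rho_at, sq_whisker; simpl; coh; reflexivity.
Qed.

Lemma runit_pmor_map (s : square (lleg f) (id1 X)) (K : M) (T : copresheaf K Y) b
    (e : span_copresheaf (square_span (id1 X) (rleg f) s) T b) :
  pmor_map (runit_pmor s) T _ e
  ≡ unit_map _ _ (expand (f := id_span X) s T _ e).
Proof.
apply span_copresheaf_val; simpl.
- unfold lambda_at, sq_whisker; simpl; coh; reflexivity.
- apply cp_act_congr; unfold rho_at; simpl; rewrite hcomp_id, vcomp1r; reflexivity.
Qed.

End Unitors.

(** * Fillers and stackings *)

Section Existence.
Context (M : bicategory).

(** [fill_psi] may fail to be invertible, hence the appeal to [lax_universal]; the inverse of its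
    first leg is [fl_tau]. *)
Lemma filler_exists (X Y Z : M) (f f' : span X Y) (g g' : span Y Z)
    (s : square (lleg g) (rleg f)) (s' : square (lleg g') (rleg f'))
    (y : pmor g g') (x : pmor f f') :
  is_bipullback s' -> groupoid_fibration (rleg f') -> inhabited (filler s s' y x).
Proof.
intros Hs Hf.
destruct (lax_universal Hs Hf
  (assoc (rleg f') (pm_h x) (sq_c s) • fill_psi s y x
     • associ (lleg g') (pm_h y) (sq_d s))) as [c [k [a [[k' [Hk Hk']] [E _]]]]].
simpl in k', Hk, Hk'.
constructor; refine (@Filler _ _ _ _ _ _ _ _ s s' y x c a k' _ _).
- exists k; split; assumption.
- rewrite <- (vcompA (_ ◁ a)), E, !vcompA, whiskerL_cancel_l by exact Hk'.
  rewrite assocK, vcomp1r; reflexivity.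
Qed.

Lemma square_map_exists (A B C : M) (n : mor A C) (p : mor B C) (s s' : square n p) :
  is_bipullback s' -> inhabited (square_map s s').
Proof.
intros Hs.
destruct (bipullback_ob Hs (sq_theta_inv s)) as [c [k [a [[k' [Hk Hk']] [Ha E]]]]].
simpl in k', Hk, Hk'.
constructor; refine (@SquareMap _ _ _ _ _ _ s s' c a k' Ha _ _).
- exists k; split; assumption.
- rewrite <- vcompA, E, !vcompA, whiskerL_cancel by exact Hk'; apply vcomp1r.
Qed.

Lemma stacking_exists (X Y Z W : M) (f : span X Y) (g : span Y Z) (h : span Z W)
    (P : square (lleg g) (rleg f)) (R : square (lleg h) (rleg g))
    (V : square (lleg g ∘ sq_c R) (rleg f)) (Q : square (lleg h) (rleg g ∘ sq_d P))
    (w : square (sq_c R) (sq_d P)) :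
  is_bipullback P -> is_bipullback w -> is_bipullback Q ->
  inhabited (@stacking M X Y Z W f g h P R V Q).
Proof.
intros HP Hw HQ.
destruct (square_map_exists (vstack w) HQ) as [vw].
(* The map from [V] to the horizontal stacking is built in two stages: [P] yields [c1], and the
   invertible [k1'] is then a square over the cospan of [w], which yields [c2]. *)
destruct (bipullback_ob HP (u := sq_c R ∘ sq_d V) (v := sq_c V)
  (th := sq_theta V • associ (lleg g) (sq_c R) (sq_d V)))
  as [c1 [k1 [x1 [[k1' [Hk1 Hk1']] [Hx1 E1]]]]].
{ apply invertible_vcomp; [apply sq_theta_inv | apply invertible_associ]. }
simpl in k1', Hk1, Hk1'.
destruct (bipullback_ob Hw (u := sq_d V) (v := c1) (th := k1'))
  as [c2 [k2 [x2 [[k2' [Hk2 Hk2']] [Hx2 E2]]]]].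
{ exists k1; split; assumption. }
simpl in k2', Hk2, Hk2'.
constructor; refine (@Stacking M X Y Z W f g h P R V Q w Hw _ vw).
refine (@SquareMap _ _ _ _ (lleg g ∘ sq_c R) (rleg f) V (hstack w) c2
  (x1 • (sq_c P ◁ x2) • assoc (sq_c P) (sq_c w) c2) k2' _ _ _).
- repeat apply invertible_vcomp; auto using invertible_hcomp, invertible_id,
    invertible_assoc.
- exists k2; split; assumption.
- assert (E : sq_whisker (s := hstack w) c2
    = (rleg f ◁ associ (sq_c P) (sq_c w) c2) • sq_whisker (sq_c w ∘ c2)
      • (lleg g ◁ sq_whisker c2) • assoc (lleg g) (sq_c R) (sq_d w ∘ c2)).
  { rewrite <- (vcompA (sq_whisker _)), <- hstack_at, !vcompA.
    rewrite whiskerL_cancel_l by apply assocK.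
    rewrite assocK; symmetry; apply vcomp1r. }
  rewrite E; simpl.
  rewrite !postcomp_comp, !vcompA, assoc_natL.
  rewrite whiskerL_cancel_l by apply associK.
  rewrite <- (vcompA (_ ◁ (_ ◁ x2))), sq_whisker_nat.
  rewrite !vcompA, <- (vcompA (_ ◁ x1)), E1, !vcompA.
  rewrite <- (vcompA (lleg g ◁ (sq_d P ◁ x2))), <- postcomp_comp, E2.
  rewrite postcomp_comp, !vcompA, whiskerL_cancel_l by exact Hk1'.
  rewrite whiskerL_cancel_l by (apply whiskerL_cancel, Hk2').
  rewrite assocK, vcomp1r; reflexivity.
Qed.

End Existence.

(** * Isomorphism classes of polynomial morphisms *)

Section Classes.
Context (M : bicategory) (X Y : M).

Lemma pmor_isomorphic_refl (f f' : span X Y) (x : pmor f f') : pmor_isomorphic x x.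
Proof.
exists (id2 _); split; [apply invertible_id|]; split; rewrite hcomp_id.
- symmetry; apply vcomp1r.
- symmetry; apply vcomp1l.
Qed.

Lemma pmor_isomorphic_sym (f f' : span X Y) (x y : pmor f f') :
  pmor_isomorphic x y -> pmor_isomorphic y x.
Proof.
intros [s [[s' [Hs Hs']] [El Er]]]; simpl in *; exists s'; split.
- exists s; split; assumption.
- split.
  + rewrite El, vcompA, whiskerL_cancel by exact Hs'; symmetry; apply vcomp1r.
  + rewrite Er, whiskerL_cancel_l by exact Hs; reflexivity.
Qed.

Lemma pmor_isomorphic_trans (f f' : span X Y) (x y z : pmor f f') :
  pmor_isomorphic x y -> pmor_isomorphic y z -> pmor_isomorphic x z.
Proof.
intros [s [Hs [El Er]]] [t [Ht [El' Er']]]; exists (t • s); split.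
- apply invertible_vcomp; assumption.
- split.
  + rewrite El, El', postcomp_comp; apply vcompA.
  + rewrite Er', Er, postcomp_comp; symmetry; apply vcompA.
Qed.

Lemma pcell_eq (f f' : span X Y) (a b : pcell f f') (x : pmor f f') :
  (forall y, pcell_mem a y <-> pmor_isomorphic x y) ->
  (forall y, pcell_mem b y <-> pmor_isomorphic x y) -> a = b.
Proof.
destruct a as [A HA], b as [B HB]; simpl; intros E E'.
assert (A = B) as <-.
{ apply functional_extensionality; intros y; apply propositional_extensionality.
  rewrite E, E'; reflexivity. }
f_equal; apply proof_irrelevance.
Qed.

Lemma cls_eq (f f' : span X Y) (x y : pmor f f') :
  pmor_isomorphic x y -> cls x = cls y.
Proof.
intros E; apply (pcell_eq (x := x)); intros z; simpl; [reflexivity|].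
split; apply pmor_isomorphic_trans; [|apply pmor_isomorphic_sym]; exact E.
Qed.

Definition pcell_repr (f f' : span X Y) (a : pcell f f') : pmor f f' :=
  proj1_sig (constructive_indefinite_description _ (pcell_class a)).

Lemma cls_repr (f f' : span X Y) (a : pcell f f') : cls (pcell_repr a) = a.
Proof.
unfold pcell_repr; destruct constructive_indefinite_description as [x Hx]; simpl.
apply (pcell_eq (x := x)); [reflexivity | exact Hx].
Qed.

Lemma pcell_repr_cls (f f' : span X Y) (x : pmor f f') :
  pmor_isomorphic (pcell_repr (cls x)) x.
Proof.
unfold pcell_repr; destruct constructive_indefinite_description as [y Hy]; simpl.
apply Hy, pmor_isomorphic_refl.
Qed.

Definition pcell_map (f f' : span X Y) (a : pcell f f') (K : M) (T : copresheaf K Y) :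
    cp_map (span_copresheaf f T) (span_copresheaf f' T) :=
  pmor_map (pcell_repr a) T.

Lemma pcell_map_cls (f f' : span X Y) (x : pmor f f') (K : M) (T : copresheaf K Y)
    b (e : span_copresheaf f T b) :
  pcell_map (cls x) T _ e ≡ pmor_map x T _ e.
Proof. apply pmor_map_iso, pcell_repr_cls. Qed.

Lemma pcell_map_nat (f f' : span X Y) (a : pcell f f') (K : M)
    (T U : copresheaf K Y) (t : cp_map T U) b (e : span_copresheaf f T b) :
  pcell_map a U _ (span_map f t _ e) ≡ span_map f' t _ (pcell_map a T _ e).
Proof. apply pmor_map_nat. Qed.

Lemma pcell_ext (f f' : span X Y) (a a' : pcell f f') :
  groupoid_fibration (rleg f') ->
  (forall (K : M) (T : copresheaf K Y) b (e : span_copresheaf f T b),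
     pcell_map a T _ e ≡ pcell_map a' T _ e) ->
  a = a'.
Proof.
intros Hf E; rewrite <- (cls_repr a), <- (cls_repr a').
apply cls_eq, pmor_isomorphic_of_map; assumption.
Qed.

End Classes.

(** * The bicategory of polynomials *)

#[local] Instance cm_proper (M : bicategory) (K X : M) (T U : copresheaf K X)
  (t : cp_map T U) (b : mor K X) :
  Morphisms.Proper (Morphisms.respectful cp_eq cp_eq) (@cm M K X T U t b).
Proof. intros x y; apply cm_eq. Qed.

Section Polynomials.
Context (M : bicategory) (neat : forall X Y : M, mor X Y -> Prop).
Context (cal : calibration neat) (ch : bipullback_choice neat).

Lemma is_polynomial_id (X : M) : is_polynomial neat (id_span X).
Proof.
split; [apply right_lifter_id | apply (cal_equiv cal)].
exists (id1 X), (luniti (id1 X)), (lunit (id1 X)); split.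
- exists (lunit (id1 X)); split; [apply lunitiK | apply lunitK].
- exists (luniti (id1 X)); split; [apply lunitK | apply lunitiK].
Qed.

Lemma poly_fib (X Y : M) (f : polynomial neat X Y) : groupoid_fibration (rleg f).
Proof. exact (cal_fib cal (poly_neat f)). Qed.

Arguments poly_fib {X Y} f.

Lemma comp_square_bipb (X Y Z : M) (g : polynomial neat Y Z) (f : polynomial neat X Y) :
  is_bipullback (comp_square ch g f).
Proof. apply chosen_bipb. Qed.

Arguments comp_square_bipb {X Y Z} g f.

Lemma comp_square_lifter (X Y Z : M) (g : polynomial neat Y Z)
    (f : polynomial neat X Y) : right_lifter (sq_c (comp_square ch g f)).
Proof.
apply right_lifter_bipullback;
  [apply comp_square_bipb | apply poly_fib | exact (poly_lifter g)].
Qed.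

Arguments comp_square_lifter {X Y Z} g f.

Lemma is_polynomial_comp (X Y Z : M) (g : polynomial neat Y Z)
    (f : polynomial neat X Y) : is_polynomial neat (comp_span ch g f).
Proof.
split.
- exact (right_lifter_comp (poly_lifter f) (comp_square_lifter g f)).
- exact (proj2 (cal_comp cal _ (poly_neat g))
    (chosen_neat ch (poly_lifter g) (poly_neat f))).
Qed.

Let poly := polynomial neat.
Let id_poly (X : M) : poly X X := Polynomial (is_polynomial_id X).
Let comp_poly (X Y Z : M) (g : poly Y Z) (f : poly X Y) : poly X Z :=
  Polynomial (is_polynomial_comp g f).
Notation "g ⋅ f" := (comp_poly g f) (at level 40, left associativity).

(** * Structure cells on isomorphism classes *)

Definition pid (X Y : M) (f : poly X Y) : pcell f f := cls (pmor_id f).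

Definition pvcomp (X Y : M) (f g h : poly X Y) (b : pcell g h) (a : pcell f g) :
    pcell f h :=
  cls (pmor_comp (pcell_repr b) (pcell_repr a)).

Lemma poly_filler_exists (X Y Z : M) (f f' : poly X Y) (g g' : poly Y Z)
    (y : pmor g g') (x : pmor f f') :
  inhabited (filler (comp_square ch g f) (comp_square ch g' f') y x).
Proof. apply filler_exists; [apply comp_square_bipb | apply poly_fib]. Qed.

Definition phcomp (X Y Z : M) (g g' : poly Y Z) (f f' : poly X Y) (b : pcell g g')
    (a : pcell f f') : pcell (g ⋅ f) (g' ⋅ f') :=
  cls (filler_pmor (epsilon (poly_filler_exists (pcell_repr b) (pcell_repr a))
    (fun _ => True))).

Lemma poly_stacking_exists (X Y Z W : M) (f : poly X Y) (g : poly Y Z)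
    (h : poly Z W) :
  inhabited (@stacking M X Y Z W f g h (comp_square ch g f) (comp_square ch h g)
    (comp_square ch (h ⋅ g) f) (comp_square ch h (g ⋅ f))).
Proof.
destruct (cal_bipb cal (comp_square_lifter h g)
  (chosen_neat ch (poly_lifter g) (poly_neat f))) as [w [Hw _]].
refine (@stacking_exists M X Y Z W f g h _ _ _ _ w (comp_square_bipb g f) Hw _).
exact (comp_square_bipb h (g ⋅ f)).
Qed.

Definition passoc (X Y Z W : M) (h : poly Z W) (g : poly Y Z) (f : poly X Y) :
    pcell ((h ⋅ g) ⋅ f) (h ⋅ (g ⋅ f)) :=
  cls (stacking_pmor (epsilon (poly_stacking_exists f g h) (fun _ => True))).

Definition plunit (X Y : M) (f : poly X Y) : pcell (id_poly Y ⋅ f) f :=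
  cls (lunit_pmor (comp_square ch (id_poly Y) f)).

Definition prunit (X Y : M) (f : poly X Y) : pcell (f ⋅ id_poly X) f :=
  cls (runit_pmor (comp_square ch f (id_poly X))).

(** * Structure cells under the expansion *)

Definition pexpand (K X Y Z : M) (g : poly Y Z) (f : poly X Y) (T : copresheaf K Z) :
    cp_map (span_copresheaf (g ⋅ f) T) (span_copresheaf f (span_copresheaf g T)) :=
  expand (f := f) (g := g) (comp_square ch g f) T.

Lemma pexpand_inj (K X Y Z : M) (g : poly Y Z) (f : poly X Y) (T : copresheaf K Z) :
  cp_injective (pexpand g f T).
Proof.
exact (expand_injective (comp_square_bipb g f) (poly_fib f) (T := T)).
Qed.

Lemma pexpand_surj (K X Y Z : M) (g : poly Y Z) (f : poly X Y) (T : copresheaf K Z) :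
  cp_surjective (pexpand g f T).
Proof.
exact (expand_surjective (comp_square_bipb g f) (poly_fib f) (T := T)).
Qed.

Lemma pexpand_nat (K X Y Z : M) (g : poly Y Z) (f : poly X Y) (T U : copresheaf K Z)
    (t : cp_map T U) b (e : span_copresheaf (g ⋅ f) T b) :
  pexpand g f U _ (span_map _ t _ e) ≡ span_map f (span_map g t) _ (pexpand g f T _ e).
Proof. exact (expand_nat (f := f) (g := g) (s := comp_square ch g f) t e). Qed.

Lemma pcell_map_id (K X Y : M) (f : poly X Y) (T : copresheaf K Y) b
    (e : span_copresheaf f T b) : pcell_map (pid f) T _ e ≡ e.
Proof. etransitivity; [apply pcell_map_cls | apply pmor_map_id]. Qed.

Lemma pcell_map_vcomp (K X Y : M) (f g h : poly X Y) (b : pcell g h) (a : pcell f g)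
    (T : copresheaf K Y) x (e : span_copresheaf f T x) :
  pcell_map (pvcomp b a) T _ e ≡ pcell_map b T _ (pcell_map a T _ e).
Proof. etransitivity; [apply pcell_map_cls | apply pmor_map_comp]. Qed.

Lemma pexpand_filler (K X Y Z : M) (g g' : poly Y Z) (f f' : poly X Y)
    (y : pmor g g') (x : pmor f f')
    (d : filler (comp_square ch g f) (comp_square ch g' f') y x)
    (T : copresheaf K Z) c (e : span_copresheaf (g ⋅ f) T c) :
  pexpand g' f' T _ (pcell_map (cls (filler_pmor d)) T _ e)
  ≡ pcell_map (cls x) _ _ (span_map f (pcell_map (cls y) T) _ (pexpand g f T _ e)).
Proof.
etransitivity; [apply cm_eq, pcell_map_cls|].
etransitivity; [apply expand_filler|].
etransitivity; [|symmetry; apply pcell_map_cls].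
apply cm_eq, span_map_ext; intros b' z; symmetry; apply pcell_map_cls.
Qed.

Lemma pexpand_hcomp (K X Y Z : M) (g g' : poly Y Z) (f f' : poly X Y)
    (b : pcell g g') (a : pcell f f') (T : copresheaf K Z) c
    (e : span_copresheaf (g ⋅ f) T c) :
  pexpand g' f' T _ (pcell_map (phcomp b a) T _ e)
  ≡ pcell_map a _ _ (span_map f (pcell_map b T) _ (pexpand g f T _ e)).
Proof.
etransitivity; [apply pexpand_filler|]; rewrite !cls_repr; reflexivity.
Qed.

Lemma pexpand_stacking (K X Y Z W : M) (h : poly Z W) (g : poly Y Z) (f : poly X Y)
    (w : @stacking M X Y Z W f g h (comp_square ch g f) (comp_square ch h g)
           (comp_square ch (h ⋅ g) f) (comp_square ch h (g ⋅ f)))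
    (T : copresheaf K W) b (e : span_copresheaf ((h ⋅ g) ⋅ f) T b) :
  pexpand g f _ _ (pexpand h (g ⋅ f) T _ (pcell_map (cls (stacking_pmor w)) T _ e))
  ≡ span_map f (pexpand h g T) _ (pexpand (h ⋅ g) f T _ e).
Proof.
etransitivity; [do 2 apply cm_eq; apply pcell_map_cls|].
etransitivity; [do 2 apply cm_eq; apply pmor_map_comp|].
etransitivity.
{ apply cm_eq.
  exact (expand_square_map (f := g ⋅ f) (g := h) (st_v w) (T := T) (b := b) _). }
etransitivity; [do 2 apply cm_eq; apply pmor_map_comp|].
etransitivity; [exact (expand_rebracket (f := f) (g := g) (h := h) (w := st_sq w) _)|].
apply cm_eq.
exact (expand_square_map (f := f) (g := h ⋅ g) (st_h w) (T := T) (b := b) e).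
Qed.

Lemma pexpand_assoc (K X Y Z W : M) (h : poly Z W) (g : poly Y Z) (f : poly X Y)
    (T : copresheaf K W) b (e : span_copresheaf ((h ⋅ g) ⋅ f) T b) :
  pexpand g f _ _ (pexpand h (g ⋅ f) T _ (pcell_map (passoc h g f) T _ e))
  ≡ span_map f (pexpand h g T) _ (pexpand (h ⋅ g) f T _ e).
Proof. apply pexpand_stacking. Qed.

Definition punit_map (K X : M) (T : copresheaf K X) :
    cp_map (span_copresheaf (id_poly X) T) T := unit_map T.

Lemma pcell_map_lunit (K X Y : M) (f : poly X Y) (T : copresheaf K Y) b
    (e : span_copresheaf (id_poly Y ⋅ f) T b) :
  pcell_map (plunit f) T _ e ≡ span_map f (punit_map T) _ (pexpand (id_poly Y) f T _ e).
Proof.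
etransitivity; [apply pcell_map_cls|].
exact (lunit_pmor_map (f := f) (s := comp_square ch (id_poly Y) f) e).
Qed.

Lemma pcell_map_runit (K X Y : M) (f : poly X Y) (T : copresheaf K Y) b
    (e : span_copresheaf (f ⋅ id_poly X) T b) :
  pcell_map (prunit f) T _ e ≡ punit_map _ _ (pexpand f (id_poly X) T _ e).
Proof.
etransitivity; [apply pcell_map_cls|].
exact (runit_pmor_map (f := f) (s := comp_square ch f (id_poly X)) e).
Qed.

(** * Independence of the chosen representatives *)

Lemma poly_ext (X Y : M) (f f' : poly X Y) (a a' : pcell f f') :
  (forall (K : M) (T : copresheaf K Y) b (e : span_copresheaf f T b),
     pcell_map a T _ e ≡ pcell_map a' T _ e) ->
  a = a'.
Proof. apply pcell_ext, poly_fib. Qed.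

Lemma pvcomp_cls (X Y : M) (f g h : poly X Y) (y : pmor g h) (x : pmor f g) :
  pvcomp (cls y) (cls x) = cls (pmor_comp y x).
Proof.
apply poly_ext; intros K T b e.
rewrite pcell_map_vcomp, !pcell_map_cls, pmor_map_comp; reflexivity.
Qed.

(** The right-hand side of [pexpand_filler] does not mention the filler, so all fillers induce the
    same map. *)
Lemma phcomp_cls (X Y Z : M) (g g' : poly Y Z) (f f' : poly X Y)
    (y : pmor g g') (x : pmor f f')
    (d : filler (comp_square ch g f) (comp_square ch g' f') y x) :
  phcomp (cls y) (cls x) = cls (filler_pmor d) :> pcell (g ⋅ f) (g' ⋅ f').
Proof.
apply poly_ext; intros K T b e; apply pexpand_inj.
etransitivity; [apply pexpand_hcomp | symmetry; apply pexpand_filler].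
Qed.

Lemma passoc_cls (X Y Z W : M) (h : poly Z W) (g : poly Y Z) (f : poly X Y)
    (w : @stacking M X Y Z W f g h (comp_square ch g f) (comp_square ch h g)
           (comp_square ch (h ⋅ g) f) (comp_square ch h (g ⋅ f))) :
  passoc h g f = cls (stacking_pmor w).
Proof.
apply (poly_ext (f := h ⋅ g ⋅ f) (f' := h ⋅ (g ⋅ f))); intros K T b e.
do 2 apply pexpand_inj.
etransitivity; [apply pexpand_assoc | symmetry; apply pexpand_stacking].
Qed.

(** * Invertibility of the associators and unitors *)

Lemma pcell_inverse (X Y : M) (f f' : poly X Y) (a : pcell f f') :
  (forall (K : M) (T : copresheaf K Y), cp_injective (pcell_map a T)) ->
  (forall (K : M) (T : copresheaf K Y), cp_surjective (pcell_map a T)) ->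
  exists z : pcell f' f, pvcomp a z = pid f' /\ pvcomp z a = pid f.
Proof.
intros inj surj.
destruct (pmor_inverse (poly_fib f) (poly_fib f') (x := pcell_repr a) inj surj)
  as [z [Hz Hz']].
exists (cls z); rewrite <- (cls_repr a), !pvcomp_cls.
split; apply cls_eq; assumption.
Qed.

(** In [pexpand_assoc] every map other than that of [passoc] is bijective, hence so is that one. *)
Lemma passoc_inverse (X Y Z W : M) (h : poly Z W) (g : poly Y Z) (f : poly X Y) :
  exists z, pvcomp (passoc h g f) z = pid (h ⋅ (g ⋅ f)) /\
            pvcomp z (passoc h g f) = pid (h ⋅ g ⋅ f).
Proof.
apply pcell_inverse; intros K T b.
- intros e e' E.
  apply pexpand_inj, (span_map_injective (t := pexpand h g T)).
  + apply pexpand_inj.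
  + apply pexpand_surj.
  + rewrite <- !pexpand_assoc, E; reflexivity.
- intros E.
  destruct (span_map_surjective (t := pexpand h g T)
    (pexpand g f _ _ (pexpand h (g ⋅ f) T _ E)) (pexpand_surj (T := T))) as [e1 H1].
  destruct (pexpand_surj e1) as [e H].
  exists e; do 2 apply pexpand_inj; rewrite pexpand_assoc, H; exact H1.
Qed.

Lemma plunit_inverse (X Y : M) (f : poly X Y) :
  exists z, pvcomp (plunit f) z = pid f /\
            pvcomp z (plunit f) = pid (id_poly Y ⋅ f).
Proof.
apply pcell_inverse; intros K T b.
- intros e e' E.
  apply pexpand_inj, (span_map_injective (t := punit_map T)).
  + apply unit_map_injective.
  + apply unit_map_surjective.
  + rewrite <- !pcell_map_lunit, E; reflexivity.
- intros E.
  destruct (span_map_surjective (t := punit_map T) E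
    (unit_map_surjective (T := T))) as [e1 H1].
  destruct (pexpand_surj e1) as [e H].
  exists e; rewrite pcell_map_lunit, H; exact H1.
Qed.

Lemma prunit_inverse (X Y : M) (f : poly X Y) :
  exists z, pvcomp (prunit f) z = pid f /\
            pvcomp z (prunit f) = pid (f ⋅ id_poly X).
Proof.
apply pcell_inverse; intros K T b.
- intros e e' E.
  apply pexpand_inj, unit_map_injective.
  etransitivity; [symmetry; exact (pcell_map_runit e)|].
  etransitivity; [exact E | exact (pcell_map_runit e')].
- intros E; destruct (unit_map_surjective E : exists x, punit_map _ _ x ≡ E) as [e1 H1].
  destruct (pexpand_surj e1) as [e H].
  exists e; rewrite pcell_map_runit, H; exact H1.
Qed.

Definition passoci (X Y Z W : M) (h : poly Z W) (g : poly Y Z) (f : poly X Y) :=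
  proj1_sig (constructive_indefinite_description _ (passoc_inverse h g f)).

Definition pluniti (X Y : M) (f : poly X Y) :=
  proj1_sig (constructive_indefinite_description _ (plunit_inverse f)).

Definition pruniti (X Y : M) (f : poly X Y) :=
  proj1_sig (constructive_indefinite_description _ (prunit_inverse f)).

Lemma passoci_spec (X Y Z W : M) (h : poly Z W) (g : poly Y Z) (f : poly X Y) :
  pvcomp (passoc h g f) (passoci h g f) = pid (h ⋅ (g ⋅ f)) /\
  pvcomp (passoci h g f) (passoc h g f) = pid (h ⋅ g ⋅ f).
Proof.
exact (proj2_sig (constructive_indefinite_description _ (passoc_inverse h g f))).
Qed.

Lemma pluniti_spec (X Y : M) (f : poly X Y) :
  pvcomp (plunit f) (pluniti f) = pid f /\
  pvcomp (pluniti f) (plunit f) = pid (id_poly Y ⋅ f).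
Proof.
exact (proj2_sig (constructive_indefinite_description _ (plunit_inverse f))).
Qed.

Lemma pruniti_spec (X Y : M) (f : poly X Y) :
  pvcomp (prunit f) (pruniti f) = pid f /\
  pvcomp (pruniti f) (prunit f) = pid (f ⋅ id_poly X).
Proof.
exact (proj2_sig (constructive_indefinite_description _ (prunit_inverse f))).
Qed.

(** * Naturality and coherence axioms *)

Lemma passoc_nat (X Y Z W : M) (h h' : poly Z W) (g g' : poly Y Z) (f f' : poly X Y)
    (c : pcell h h') (b : pcell g g') (a : pcell f f') :
  pvcomp (passoc h' g' f') (phcomp (phcomp c b) a)
  = pvcomp (phcomp c (phcomp b a)) (passoc h g f).
Proof.
apply poly_ext; intros K T x e; do 2 apply pexpand_inj.
rewrite !pcell_map_vcomp, pexpand_assoc, !pexpand_hcomp, pexpand_nat, pexpand_assoc.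
rewrite <- pcell_map_nat; apply cm_eq.
apply span_copresheaf_val; [reflexivity | apply pexpand_hcomp].
Qed.

Lemma phcomp_id (X Y Z : M) (g : poly Y Z) (f : poly X Y) :
  phcomp (pid g) (pid f) = pid (g ⋅ f).
Proof.
apply poly_ext; intros K T x e; apply pexpand_inj.
rewrite pexpand_hcomp, !pcell_map_id.
apply span_copresheaf_val; [reflexivity | apply pcell_map_id].
Qed.

Lemma phcomp_vcomp (X Y Z : M) (g g' g'' : poly Y Z) (f f' f'' : poly X Y)
    (b' : pcell g' g'') (b : pcell g g') (a' : pcell f' f'') (a : pcell f f') :
  phcomp (pvcomp b' b) (pvcomp a' a) = pvcomp (phcomp b' a') (phcomp b a).
Proof.
apply poly_ext; intros K T x e; apply pexpand_inj.
rewrite pcell_map_vcomp, !pexpand_hcomp, pcell_map_vcomp; apply cm_eq.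
etransitivity; [|apply pcell_map_nat]; apply cm_eq.
apply span_copresheaf_val; [reflexivity | apply pcell_map_vcomp].
Qed.

Lemma plunit_nat (X Y : M) (f f' : poly X Y) (a : pcell f f') :
  pvcomp (plunit f') (phcomp (pid (id_poly Y)) a) = pvcomp a (plunit f).
Proof.
apply poly_ext; intros K T x e.
rewrite !pcell_map_vcomp, !pcell_map_lunit, pexpand_hcomp.
etransitivity; [|symmetry; apply pcell_map_nat]; do 2 apply cm_eq.
apply span_copresheaf_val; [reflexivity | apply pcell_map_id].
Qed.

Lemma prunit_nat (X Y : M) (f f' : poly X Y) (a : pcell f f') :
  pvcomp (prunit f') (phcomp a (pid (id_poly X))) = pvcomp a (prunit f).
Proof.
apply poly_ext; intros K T x e.
rewrite !pcell_map_vcomp, !pcell_map_runit, pexpand_hcomp, pcell_map_id.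
apply unit_map_nat.
Qed.

(** After expansion both sides collapse the middle action, that of the identity span, by
    [punit_map]. *)
Lemma ptriangle (X Y Z : M) (g : poly Y Z) (f : poly X Y) :
  pvcomp (phcomp (pid g) (plunit f)) (passoc g (id_poly Y) f)
  = phcomp (prunit g) (pid f).
Proof.
apply poly_ext; intros K T x e; apply pexpand_inj.
rewrite !pcell_map_vcomp, !pexpand_hcomp, pcell_map_id, pcell_map_lunit.
etransitivity; [apply cm_eq, pexpand_nat|].
etransitivity; [do 2 apply cm_eq; apply pexpand_assoc|].
apply span_copresheaf_val; [reflexivity|].
etransitivity; [apply unit_map_nat|].
etransitivity; [apply pcell_map_id | symmetry; apply pcell_map_runit].
Qed.

Lemma ppentagon (X Y Z W V : M) (k : poly W V) (h : poly Z W) (g : poly Y Z)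
    (f : poly X Y) :
  pvcomp (passoc k h (g ⋅ f)) (passoc (k ⋅ h) g f)
  = pvcomp (phcomp (pid k) (passoc h g f))
      (pvcomp (passoc k (h ⋅ g) f) (phcomp (passoc k h g) (pid f))).
Proof.
apply poly_ext; intros K T x e; do 3 apply pexpand_inj.
rewrite !pcell_map_vcomp.
(* The common value is the full expansion of the leftmost bracketing into four nested actions. *)
transitivity (span_map f (span_map g (pexpand k h T)) _
  (span_map f (pexpand (k ⋅ h) g T) _ (pexpand (k ⋅ h ⋅ g) f T _ e))).
{ etransitivity; [apply cm_eq, pexpand_assoc|].
  etransitivity; [apply pexpand_nat|].
  apply cm_eq, pexpand_assoc. }
symmetry.
etransitivity; [do 2 apply cm_eq; apply pexpand_hcomp|].
etransitivity; [apply pexpand_assoc|].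
(* The two outer factors of the longer path are evaluated first; what remains is [pexpand_assoc] for
   [k], [h], [g] inside the action of [f]. *)
transitivity (span_map f (pexpand h g _) _ (span_map f (pexpand k (h ⋅ g) T) _
  (span_map f (pcell_map (passoc k h g) T) _ (pexpand (k ⋅ h ⋅ g) f T _ e)))).
- apply cm_eq.
  etransitivity.
  { apply cm_eq.
    apply span_copresheaf_val; [reflexivity | apply pcell_map_id]. }
  etransitivity; [apply pexpand_assoc|]; apply cm_eq.
  etransitivity; [apply pexpand_hcomp | apply pcell_map_id].
- apply span_copresheaf_val; [reflexivity | apply pexpand_assoc].
Qed.

Definition poly_struct : bicat_struct (poly_frame is_polynomial_id is_polynomial_comp).
Proof.
refine (@BicatStruct (poly_frame is_polynomial_id is_polynomial_comp)
  pid pvcomp phcomp passoc passoci plunit pluniti prunit pruniti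
  _ _ _ phcomp_id phcomp_vcomp passoc_nat plunit_nat prunit_nat
  (fun X Y Z W h g f => proj1 (passoci_spec h g f))
  (fun X Y Z W h g f => proj2 (passoci_spec h g f))
  (fun X Y f => proj1 (pluniti_spec f)) (fun X Y f => proj2 (pluniti_spec f))
  (fun X Y f => proj1 (pruniti_spec f)) (fun X Y f => proj2 (pruniti_spec f))
  ptriangle ppentagon);
  (* The category laws for vertical composition hold because they hold for composition of maps. *)
  intros; apply poly_ext; intros K T x e; rewrite !pcell_map_vcomp.
- reflexivity.
- apply pcell_map_id.
- rewrite pcell_map_id; reflexivity.
Defined.

End Polynomials.

Theorem proposition17 (M : bicategory) (neat : forall X Y : M, mor X Y -> Prop)
    (cal : calibration neat) (ch : bipullback_choice neat) :
  exists (Hid : forall X : M, is_polynomial neat (id_span X))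
         (Hcomp : forall (X Y Z : M) (g : polynomial neat Y Z) (f : polynomial neat X Y),
            is_polynomial neat (comp_span ch g f))
         (PolyM : bicat_struct (poly_frame Hid Hcomp)),
    poly_homcategories PolyM /\
    poly_composition PolyM /\
    poly_associativity PolyM.
Proof.
exists (is_polynomial_id cal),
  (fun X Y Z => @is_polynomial_comp M neat cal ch X Y Z), (poly_struct cal ch).
split; [|split].
- split; [reflexivity | intros; apply (pvcomp_cls cal)].
- intros X Y Z f f' g g' y x; split; [apply (poly_filler_exists cal)|].
  intros d; apply (phcomp_cls cal).
- intros X Y Z W f g h; split; [apply poly_stacking_exists|].
  intros w; apply passoc_cls.
Qed.
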